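(* Let $k$ be an integer with $k \ge 1$ and let $G$ be a $k$-connected graph of order at least three. If $$\sigma_{k+1}(G) \ge n(G)+\kappa(G)+(k-2)(\alpha(G)-1),$$ then $G$ is Hamiltonian, that is, $G$ has a cycle containing all the vertices of $G$.
   Context: All graphs are finite, undirected, without loops or multiple edges. For a graph $G$: $n(G)$ is the number of vertices (the order) of $G$; $\alpha(G)$ is the maximum cardinality of an independent set of $G$; $d_G(x)$ is the degree of a vertex $x$. For distinct $x,y\in V(G)$, $\kappa_G(x,y)$ is the maximum number of internally-disjoint paths connecting $x$ and $y$ in $G$; $G$ is $k$-connected if $\kappa_G(x,y)\ge k$ for any two distinct vertices $x,y\in V(G)$, and the connectivity $\kappa(G)$ is the maximum $k$ for which $G$ is $k$-connected (so $\kappa(K_n)=n-1$ for $n \ge 2$). For a positive integer $j$, if $\alpha(G)\ge j$ then $$\sigma_j(G)=\min\Big\{\sum_{x\in X}d_G(x) : X \text{ is an independent set in } G \text{ with } |X|=j\Big\},$$ and otherwise $\sigma_j(G)=+\infty$. *)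

(* Defs.v *)
(* A graph is a symmetric irreflexive relation on a finite type. *)
From mathcomp Require Import all_boot all_order all_algebra.
From mathcomp Require Import constructive_ereal.

Set Implicit Arguments.
Unset Strict Implicit.
Unset Printing Implicit Defensive.

Section Graph.
Variables (T : finType) (e : rel T).
Implicit Types (x y : T) (X : {set T}) (k j : nat).

Definition degree x : nat := #|[set y | e x y]|.

Definition independent X : bool :=
  [forall x in X, forall y in X, ~~ e x y].

Definition alpha : nat := \max_(X : {set T} | independent X) #|X|.

(* The path with vertices x :: p. *)
Definition is_path x y (p : seq T) : bool :=
  [&& path e x p, last x p == y & uniq (x :: p)].

(* The paths x :: p and x :: q share no vertex other than x and y. *)
Definition internally_disjoint x y (p q : seq T) : bool :=
  [forall z, (z \in x :: p) && (z \in x :: q) ==> (z \in [:: x; y])].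

(* A path has at most #|T| vertices, so length at most #|T| is no restriction.
   As P is a set, the one-edge path from x to y is counted at most once. *)
Definition disjoint_paths x y (P : {set #|T|.-bseq T}) : bool :=
  [forall p in P, is_path x y p] &&
  [forall p in P, forall q in P, (p != q) ==> internally_disjoint x y p q].

Definition local_connectivity x y : nat :=
  \max_(P : {set #|T|.-bseq T} | disjoint_paths x y P) #|P|.

Definition k_connected k : bool :=
  [forall x, forall y, (x != y) ==> (k <= local_connectivity x y)].

(* The bound k < #|T| only makes the maximum finite: by k_connected_ltn it is
   automatic as soon as there are two vertices. *)
Definition connectivity : nat := \max_(k < #|T| | k_connected k) k.

Definition sigma j : \bar int :=
  \big[Order.min/+oo%E]_(X : {set T} | independent X && (#|X| == j))
    (Posz (\sum_(x in X) degree x))%:E.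

Definition is_cycle (c : seq T) : bool :=
  [&& 2 < size c, cycle e c & uniq c].

Definition hamiltonian : Prop :=
  exists2 c : seq T, is_cycle c & forall x, x \in c.

Lemma internally_disjoint_head x y (p q : seq T) :
  x != y -> is_path x y p -> is_path x y q -> internally_disjoint x y p q ->
  head x p = head x q -> p = q.
Proof.
move=> nxy; case: p => [|a p]; first by rewrite /is_path /= (negPf nxy).
case: q => [|b q]; first by rewrite /is_path /= (negPf nxy).
case/and3P => _ /= lp /and3P[xp ap _]; case/and3P => _ /= lq /and3P[_ bq _].
move=> /forallP/(_ a) + ab; rewrite -{b}ab in lq bq *.
have nax : a != x by apply: contraNneq xp => <-; rewrite inE eqxx.
rewrite !inE eqxx (negPf nax) /= => /eqP ay.
case: p lp ap {xp} => [|c p] /= /eqP lp; last first.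
  by rewrite ay -lp mem_last.
move=> _; case: q lq bq => [|d q] //= /eqP lq.
by rewrite ay -lq mem_last.
Qed.

Lemma disjoint_paths_card x y (P : {set #|T|.-bseq T}) :
  x != y -> disjoint_paths x y P -> #|P| < #|T|.
Proof.
move=> nxy /andP[/forall_inP hP /forall_inP hD].
pose f (p : #|T|.-bseq T) := head x p.
have injf : {in P &, injective f}.
  move=> p q pP qP hpq; case: (eqVneq p q) => // npq.
  have /forall_inP/(_ _ qP)/implyP/(_ npq) hd := hD _ pP.
  apply: val_inj.
  exact: (internally_disjoint_head nxy (hP _ pP) (hP _ qP) hd hpq).
rewrite -(card_in_imset injf); apply: (@leq_ltn_trans #|[set~ x]|).
  apply: subset_leq_card; apply/subsetP => _ /imsetP[p pP ->].
  have := hP _ pP; rewrite !inE /f /is_path.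
  case: (bseqval p) => [|a s] /=; first by rewrite (negPf nxy).
  by case/and3P => _ _ /andP[]; rewrite inE negb_or eq_sym => /andP[].
by rewrite cardsC1 ltn_predL; apply/card_gt0P; exists x.
Qed.

Lemma k_connected_ltn k : 1 < #|T| -> k_connected k -> k < #|T|.
Proof.
case/card_gt1P => x [y [_ _ nxy]] /forallP/(_ x)/forallP/(_ y)/implyP/(_ nxy).
move=> /leq_ltn_trans; apply; rewrite /local_connectivity.
by apply: (big_ind (fun m => m < #|T|)) => [|m n|P /(disjoint_paths_card nxy)//];
  [apply/card_gt0P; exists x | rewrite gtn_max => -> ->].
Qed.

Lemma connectivityP k : 1 < #|T| -> k_connected k = (k <= connectivity).
Proof.
move=> T1; apply/idP/idP => [hk|].
  exact: (leq_bigmax_cond (Ordinal (k_connected_ltn T1 hk))).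
have mono m n : m <= n -> k_connected n -> k_connected m.
  move=> mn /forallP hn; apply/forallP => x; apply/forallP => y.
  apply/implyP => nxy; apply: leq_trans mn _.
  by have /forallP/(_ y)/implyP/(_ nxy) := hn x.
move/mono; apply; rewrite /connectivity.
apply: (big_ind (fun m => k_connected m)) => //.
  by apply/forallP => x; apply/forallP => y; apply/implyP.
by move=> m n hm hn; rewrite /maxn; case: ifP.
Qed.

End Graph.

(* Main.v *)
Require Import Defs.
From mathcomp Require Import all_boot all_order all_algebra.
From mathcomp Require Import constructive_ereal.
From mathcomp Require Import zify.

Set Implicit Arguments.
Unset Strict Implicit.
Unset Printing Implicit Defensive.

(** Suppose that the graph is not Hamiltonian.  Write n for its order, kappa
    for its connectivity and alpha for its independence number; let c be a
    longest cycle (an edge counts as a cycle of length two), x a vertex off c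
    and H the component of x in the complement of c.  A vertex of c is attached
    if it has a neighbour in H, and the successors on c of the attached vertices
    are the labels.  Every forbidden pattern of edges at the labels
    ([label_indep], [off_one_label], [cross_order], [cross_adjacent],
    [ladder_left], [ladder_right]) is refuted in the same way: cut c at a few
    vertices and reassemble the pieces, some of them reversed, together with a
    path through H into a longer cycle.

    The degrees of a set Y of labels are then summed by letting every vertex z
    of c pay for its neighbours in Y ([label_degree_sum]).  Read c from a label
    y1 of Y; z pays one unit for its first neighbour in Y to the left of z and
    one for the last to the right.  By [cross_order] a vertex that pays to the
    left is not preceded by one that pays to the right, so these units amount to
    at most one per vertex.  The remaining adjacencies concern vertices z
    adjacent to p such that p lies between z and another neighbour of z in Y;
    by [cross_adjacent] the predecessors of these z form, together with x, an
    independent set ([between_indep]), so there are at most alpha - 1 of them,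
    and none is counted for the first and the last label of Y.  Applied to k
    labels, with x added, the hypothesis on sigma shows that x has more than
    kappa neighbours on c ([off_nbrs]).

    Now choose c and x so that the number m of neighbours of x on c is as large
    as possible, and keep only the set L of successors of these neighbours.  A
    vertex v of L is good if it can be exchanged with x ([swap_vertex]) and has no
    neighbour off c; then its degree is at most m, hence less than alpha.  Every
    other vertex of L is bad and provides a vertex that pays nothing
    ([succs_degree_sum]).  It follows that more than kappa vertices of L are
    good and that any two vertices of L have more than kappa common neighbours
    ([good_card], [pair_common]).

    By Menger's theorem some set S of at most kappa vertices separates the graph
    ([separation]).  Two vertices of L on different sides would have all their
    common neighbours in S, so P = L - S lies on one side; let b be a vertex of
    the other side B.  It is adjacent to no vertex of P, but to all good
    vertices of L except at most k - 2 of them and one vertex of P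
    ([good_nonadj]).  Let j and i be the first and the last neighbour of b in L,
    and add to them a set U of at most k - 2 vertices of P.  For this set the
    predecessor of b enlarges every independent set of [between_indep]
    ([no_conflict]), which saves one unit per element of U and leaves
    |U| + |bad vertices other than i, j and U| + kappa < m ([excess_bound]).
    But P has at least m - kappa elements, and U can be chosen so as to
    contradict this ([far_side_contradiction]).

    For k = 1 a separating set already contradicts the hypothesis, because
    alpha > kappa ([sigma2_contradiction]). *)

(** * Walks, clock positions and pieces of a cycle *)

(** Discarding the hypotheses that are not about numbers keeps [lia] from
    searching through boolean facts on graphs; the change of sort makes sizes and
    cardinals syntactically equal when they are equal. *)
Ltac nat_lia := repeat match goal with H : ?P |- _ =>
    lazymatch P with
    | is_true (leq _ _) => fail
    | is_true (andb (leq _ _) _) => fail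
    | is_true (negb (leq _ _)) => fail
    | @eq bool (leq _ _) _ => fail
    | @eq ?A ?a ?b => tryif unify A nat then fail else clear H
    | _ => clear H
    end end;
  change (Equality.sort (fintype_Finite__to__eqtype_Equality ?U)) with (Finite.sort U) in *;
  lia.

Ltac case_ifs := repeat match goal with
  | |- context [if leq ?a ?b then _ else _] => case: (leqP a b) => ? end.

Ltac size_lia := repeat match goal with
  | |- context [@size (Equality.sort (fintype_Finite__to__eqtype_Equality ?U)) ?s] =>
    change (@size (Equality.sort (fintype_Finite__to__eqtype_Equality U)) s)
      with (@size (Finite.sort U) s)
  | H : context [@size (Equality.sort (fintype_Finite__to__eqtype_Equality ?U)) ?s] |- _ =>
    change (@size (Equality.sort (fintype_Finite__to__eqtype_Equality U)) s)
      with (@size (Finite.sort U) s) in H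
  end; nat_lia.

Section Walk.
Variables (T : finType) (e : rel T).

(** The vertices are kept in one sequence with both ends named, so that pieces of
    a cycle can be concatenated and reversed without special first elements. *)
Definition walk x s y :=
  if s is z :: t then [&& z == x, path e z t & last z t == y] else false.

Lemma walk1 x : walk x [:: x] x.
Proof. by rewrite /= !eqxx. Qed.

Lemma walk_cat x s y x' s' y' :
  walk x s y -> e y x' -> walk x' s' y' -> walk x (s ++ s') y'.
Proof.
case: s => // z t /and3P[zx pt /eqP<-] ee; case: s' => // z' t'.
move=> /and3P[/eqP zx' pt' lt']; rewrite /= zx cat_path pt last_cat /= lt' zx'.
by rewrite ee -zx' pt'.
Qed.

Lemma walk_cycle x s y : walk x s y -> e y x -> cycle e s.
Proof.
case: s => // z t /and3P[/eqP-> pt /eqP<-] ee /=.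
by rewrite rcons_path pt.
Qed.

Lemma walk_rev x s y : symmetric e -> walk x s y -> walk y (rev s) x.
Proof.
move=> es; case: s => // z t /and3P[/eqP<- pt /eqP<-] {x y}.
elim: t z pt => [|a t IH] z; first by rewrite /= !eqxx.
move=> /= /andP[za pt]; rewrite rev_cons -cats1.
apply: (walk_cat (IH _ pt)); last exact: walk1.
by rewrite es.
Qed.

Lemma walk_neq0 x s y : walk x s y -> s != [::].
Proof. by case: s. Qed.

Lemma walk_head x s y : walk x s y -> x \in s.
Proof. by case: s => // z t /andP[/eqP-> _]; rewrite mem_head. Qed.

Lemma walk_last x s y : walk x s y -> y \in s.
Proof. by case: s => // z t /and3P[_ _ /eqP<-]; rewrite mem_last. Qed.

Lemma walk_split x s y z : walk x s y -> z \in s ->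
  exists s1 s2, [/\ s = s1 ++ s2, walk z s2 y & walk x (rcons s1 z) z].
Proof.
case: s => // a t /and3P[/eqP-> pt /eqP<-].
rewrite inE => /predU1P[->|].
  by exists [::], (x :: t); rewrite /= !eqxx pt.
move=> zt; case/splitPr: zt pt => t1 t2; rewrite cat_path last_cat /= => /and3P[p1 ez p2] .
exists (x :: t1), (z :: t2); split=> //=; first by rewrite eqxx p2 /=.
by rewrite eqxx rcons_path p1 ez last_rcons eqxx.
Qed.

Lemma walk_uniq x s y : walk x s y -> exists2 s', walk x s' y & uniq s' /\ {subset s' <= s}.
Proof.
case: s => // a t /and3P[/eqP-> pt /eqP<-].
case: (shortenP pt) => t' pt' ut' st'; exists (x :: t'); first by rewrite /= !eqxx pt'.
split=> // z; rewrite !inE => /predU1P[->|/st' ->]; rewrite ?eqxx ?orbT //.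
Qed.

(** Positions are compared after rotating the cycle so that it starts at p; the
    case distinction, instead of a remainder modulo the size, lets linear
    arithmetic decide all questions of cyclic order. *)
Definition clock (c : seq T) (p x : T) :=
  if index p c <= index x c then index x c - index p c
  else index x c + size c - index p c.

Lemma index_rot_clock (c : seq T) p x : uniq c -> p \in c -> x \in c ->
  index x (rot (index p c) c) = clock c p x.
Proof.
move=> uc pc xc; have ip : index p c < size c by rewrite index_mem.
have ix : index x c < size c by rewrite index_mem.
rewrite /rot index_cat /clock.
have [le|lt] := leqP (index p c) (index x c).
  have xE : nth p (drop (index p c) c) (index x c - index p c) = x.
    by rewrite nth_drop subnKC // nth_index.
  have sz : index x c - index p c < size (drop (index p c) c).
    by rewrite size_drop; size_lia.
  have xd : x \in drop (index p c) c by rewrite -xE mem_nth.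
  by rewrite xd -{1}xE index_uniq ?drop_uniq.
have xt : x \in take (index p c) c by rewrite in_take.
have -> : (x \in drop (index p c) c) = false.
  apply/negbTE/negP => xd; move: uc; rewrite -(cat_take_drop (index p c) c).
  by rewrite cat_uniq => /and3P[_ /hasP[]]; exists x.
have -> : index x (take (index p c) c) = index x c.
  by have := index_cat x (take (index p c) c) (drop (index p c) c); rewrite cat_take_drop xt.
by rewrite size_drop; size_lia.
Qed.

Lemma clock_lt (c : seq T) p x : p \in c -> x \in c -> clock c p x < size c.
Proof. by rewrite -!index_mem /clock => ? ?; case: ifP => ?; size_lia. Qed.

(** With one base b, cyclic order becomes linear order of numbers. *)
Lemma clock_base (c : seq T) b p x : b \in c -> p \in c -> x \in c ->
  clock c p x = if clock c b p <= clock c b x then clock c b x - clock c b p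
                else clock c b x + size c - clock c b p.
Proof.
rewrite -!index_mem /clock.
move: (index b c) (index p c) (index x c) (size c) => i j k N hi hj hk.
by case: (leqP j k) => ?; case: (leqP i j) => ?; case: (leqP i k) => ?; case: leqP => ?; lia.
Qed.

Lemma clock0 (c : seq T) p : clock c p p = 0.
Proof. by rewrite /clock leqnn subnn. Qed.

Lemma clock_inj (c : seq T) p x y : p \in c -> x \in c -> y \in c ->
  clock c p x = clock c p y -> x = y.
Proof.
move=> pc xc yc h; rewrite -[x](nth_index p xc) -[y](nth_index p yc); congr nth.
move: pc xc yc h; rewrite -!index_mem /clock.
by case: (leqP (index p c) (index x c)) => ?; case: (leqP (index p c) (index y c)) => ?;
  size_lia.
Qed.

Definition cseg (c : seq T) i j := drop i (take j c).

Lemma walk_cseg c x0 i j : path e (head x0 c) (behead c) -> i < j <= size c ->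
  walk (nth x0 c i) (cseg c i j) (nth x0 c j.-1).
Proof.
move=> pc /andP[ij js]; rewrite /cseg.
have sz : size (take j c) = j by rewrite size_takel.
have hd : drop i (take j c) = nth x0 c i :: drop i.+1 (take j c).
  by rewrite (drop_nth x0) ?sz // nth_take.
have st : sorted e c by case: (c) pc.
have := drop_sorted i (take_sorted j st); rewrite hd /= eqxx => -> /=.
rewrite -[last _ _]/(last x0 (nth x0 c i :: drop i.+1 (take j c))) -hd.
by rewrite -nth_last size_drop sz nth_drop nth_take; [apply/eqP; congr nth|]; size_lia.
Qed.

Lemma cseg_cat (c : seq T) i j k : i <= j <= k -> cseg c i j ++ cseg c j k = cseg c i k.
Proof.
move=> /andP[ij jk]; rewrite /cseg.
have tk a b : a <= b -> drop a (take b c) = take (b - a) (drop a c).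
  by move=> ab; rewrite take_drop subnK.
rewrite !tk //; last by apply: leq_trans jk.
have -> : k - i = (j - i) + (k - j) by lia.
rewrite takeD; by rewrite drop_drop subnK.
Qed.

Lemma cycle_path_rot c p : cycle e c -> p \in c ->
  let c' := rot (index p c) c in path e (head p c') (behead c').
Proof.
move=> cc pc; rewrite -(rot_cycle (index p c)) in cc.
by case: (rot _ _) cc => //= a t; rewrite rcons_path => /andP[].
Qed.

Lemma cut_walk c p i j x y : uniq c -> cycle e c -> p \in c -> x \in c -> y \in c ->
  clock c p x = i -> clock c p y = j.-1 -> i < j ->
  walk x (cseg (rot (index p c) c) i j) y.
Proof.
move=> uc cc pc xc yc <- hj ij.
have js := clock_lt pc yc.
have h : clock c p x < j <= size (rot (index p c) c) by rewrite size_rot; size_lia.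
have := walk_cseg (cycle_path_rot cc pc) h.
rewrite -(index_rot_clock uc pc xc) -[j in nth _ _ j.-1]/j -hj -(index_rot_clock uc pc yc).
by rewrite !nth_index ?mem_rot.
Qed.

Lemma clock_prev (c : seq T) p x : uniq c -> p \in c -> x \in c ->
  clock c p (prev c x) = if x == p then (size c).-1 else (clock c p x).-1.
Proof.
move=> uc pc xc.
rewrite -index_rot_clock ?mem_prev // -(prev_rot (index p c)) //.
rewrite -index_rot_clock // prev_nth mem_rot xc.
have urc : uniq (rot (index p c) c) by rewrite rot_uniq.
case E: (rot (index p c) c) => [|a t]; first by move: (mem_rot (index p c) c p); rewrite pc E.
have ap : a = p.
  by have := rot_index pc; rewrite E => -[].
rewrite ap in E *.
have pt : p \notin t by move: urc; rewrite E /= => /andP[].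
have ut : uniq (p :: t) by rewrite -E.
have sc : size c = (size t).+1 by rewrite -(size_rot (index p c)) E.
case: (eqVneq x p) => [->|np].
  by rewrite [index p t]memNindex // index_uniq //= sc.
have xt : x \in t by move: (mem_rot (index p c) c x); rewrite E xc inE (negPf np).
have := xt; rewrite -index_mem => lt.
by rewrite index_uniq //= ?ltnS ?(ltnW lt) // eq_sym (negPf np).
Qed.

Lemma clock_prev_head (c : seq T) p : uniq c -> p \in c ->
  clock c p (prev c p) = (size c).-1.
Proof. by move=> uc pc; rewrite clock_prev // eqxx. Qed.

Lemma clock_prev_pos (c : seq T) p x : uniq c -> p \in c -> x \in c ->
  0 < clock c p x -> clock c p (prev c x) = (clock c p x).-1.
Proof.
move=> uc pc xc h; rewrite clock_prev //; case: eqP => // xp.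
by move: h; rewrite xp clock0.
Qed.

Lemma clock_next (c : seq T) p x : uniq c -> p \in c -> x \in c ->
  (clock c p x).+1 < size c -> clock c p (next c x) = (clock c p x).+1.
Proof.
move=> uc pc xc h; have nc : next c x \in c by rewrite mem_next.
have := clock_prev uc pc nc; rewrite prev_next //.
case: eqP => [->|np]; rewrite ?clock0; first size_lia.
case E: (clock c p (next c x)) => [|m] /= -> //.
by case: np; apply: (clock_inj pc nc pc); rewrite clock0.
Qed.

Lemma prev_inj (c : seq T) : uniq c -> injective (prev c).
Proof. by move=> uc; apply: can_inj (next_prev uc). Qed.

Lemma next_inj (c : seq T) : uniq c -> injective (next c).
Proof. by move=> uc; apply: can_inj (prev_next uc). Qed.

Section Cut.
Variable c : seq T.
Hypotheses (uc : uniq c) (cc : cycle e c).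
Let perm_cseg p : p \in c -> perm_eq c (cseg (rot (index p c) c) 0 (size c)).
Proof.
move=> pc; rewrite /cseg drop0 take_oversize ?size_rot //.
by rewrite perm_sym perm_rot.
Qed.

(** The lemmas [cut1] to [cut5] cut a cycle in front of the given vertices: each
    piece runs from one of them to the predecessor of the next, as recorded by
    [prev].  The assembly of a new cycle then only uses the walks, and that it
    has the right vertices only uses the permutation. *)
Lemma cut1 p : p \in c -> exists s0, perm_eq c s0 /\ walk p s0 (prev c p).
Proof.
move=> pc; have lt := clock_lt pc pc.
exists (cseg (rot (index p c) c) 0 (size c)); split; first exact: perm_cseg.
by apply: cut_walk; rewrite ?mem_prev ?clock0 ?clock_prev_head //; size_lia.
Qed.

Ltac cuts :=
  apply: cut_walk; rewrite ?mem_prev ?clock0 ?clock_prev_head ?clock_prev_pos //; size_lia.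

Lemma cut2 p x : p \in c -> x \in c -> 0 < clock c p x ->
  exists s0 s1, [/\ perm_eq c (s0 ++ s1), walk p s0 (prev c x) & walk x s1 (prev c p)].
Proof.
move=> pc xc h; have lt := clock_lt pc xc; set r := rot (index p c) c.
exists (cseg r 0 (clock c p x)), (cseg r (clock c p x) (size c)).
split; first by rewrite cseg_cat ?perm_cseg //; size_lia.
all: cuts.
Qed.

Lemma cut3 p x y : p \in c -> x \in c -> y \in c -> 0 < clock c p x < clock c p y ->
  exists s0 s1 s2, [/\ perm_eq c (s0 ++ s1 ++ s2), walk p s0 (prev c x),
     walk x s1 (prev c y) & walk y s2 (prev c p)].
Proof.
move=> pc xc yc /andP[h0 h1]; have lt := clock_lt pc yc; set r := rot (index p c) c.
exists (cseg r 0 (clock c p x)), (cseg r (clock c p x) (clock c p y)),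
  (cseg r (clock c p y) (size c)).
split; first by rewrite !cseg_cat ?perm_cseg //; size_lia.
all: cuts.
Qed.

Lemma cut4 p x y z : p \in c -> x \in c -> y \in c -> z \in c ->
  0 < clock c p x < clock c p y -> clock c p y < clock c p z ->
  exists s0 s1 s2 s3, [/\ perm_eq c (s0 ++ s1 ++ s2 ++ s3), walk p s0 (prev c x),
     walk x s1 (prev c y), walk y s2 (prev c z) & walk z s3 (prev c p)].
Proof.
move=> pc xc yc zc /andP[h0 h1] h2; have lt := clock_lt pc zc; set r := rot (index p c) c.
exists (cseg r 0 (clock c p x)), (cseg r (clock c p x) (clock c p y)),
  (cseg r (clock c p y) (clock c p z)), (cseg r (clock c p z) (size c)).
split; first by rewrite !cseg_cat ?perm_cseg //; size_lia.
all: cuts.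
Qed.

Lemma cut5 p x y z w : p \in c -> x \in c -> y \in c -> z \in c -> w \in c ->
  0 < clock c p x < clock c p y -> clock c p y < clock c p z < clock c p w ->
  exists s0 s1 s2 s3 s4, [/\ perm_eq c (s0 ++ s1 ++ s2 ++ s3 ++ s4),
     walk p s0 (prev c x), walk x s1 (prev c y), walk y s2 (prev c z) &
     walk z s3 (prev c w) /\ walk w s4 (prev c p)].
Proof.
move=> pc xc yc zc wc /andP[h0 h1] /andP[h2 h3]; have lt := clock_lt pc wc.
set r := rot (index p c) c.
exists (cseg r 0 (clock c p x)), (cseg r (clock c p x) (clock c p y)),
  (cseg r (clock c p y) (clock c p z)), (cseg r (clock c p z) (clock c p w)),
  (cseg r (clock c p w) (size c)).
split; first by rewrite !cseg_cat ?perm_cseg //; size_lia.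
4: split.
all: cuts.
Qed.

End Cut.
End Walk.

(** * Longest cycles: forbidden crossings *)

(** No lower bound on the size: an edge is a closed walk of length two, which
    saves the case of graphs without proper cycles. *)
Definition longest (T : finType) (e : rel T) (c : seq T) :=
  [/\ cycle e c, uniq c & forall d, cycle e d -> uniq d -> size d <= size c].

Definition off_rel (T : finType) (e : rel T) (c : seq T) : rel T :=
  fun u v => [&& e u v, u \notin c & v \notin c].

Definition component (T : finType) (e : rel T) (c : seq T) (x : T) : {set T} :=
  [set h | connect (off_rel e c) x h].

Definition attached (T : finType) (e : rel T) (c : seq T) (x u : T) :=
  [exists h in component e c x, e u h].

(** The labels are the set usually written N(H)^+, for H the component of x. *)
Definition label (T : finType) (e : rel T) (c : seq T) (x v : T) :=
  (v \in c) && attached e c x (prev c v).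

Section Crossing.
Variables (T : finType) (e : rel T) (c : seq T) (x : T).
Hypotheses (es : symmetric e) (ei : irreflexive e) (cl : longest e c) (xc : x \notin c).
Let cc : cycle e c. Proof. by case: cl. Qed.
Let uc : uniq c. Proof. by case: cl. Qed.
Local Notation H := (component e c x).
Local Notation attached := (attached e c x).
Local Notation label := (label e c x).
Local Notation "p ^-" := (prev c p) (at level 2, format "p ^-").
Local Notation ck := (clock c).

Lemma off_rel_sym : symmetric (off_rel e c).
Proof. by move=> u v; rewrite /off_rel es [(u \notin c) && _]andbC. Qed.

Lemma component_self : x \in H. Proof. by rewrite inE connect0. Qed.

Lemma component_off h : h \in H -> h \notin c.
Proof.
rewrite inE => /connectP[p pp ->]; elim: p x xc pp => //= a p IH y yc.
by case/andP => /and3P[_ _ ac]; apply: IH.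
Qed.

Lemma component_edge h o : h \in H -> o \notin c -> e h o -> o \in H.
Proof.
move=> hH oc eho; have hc := component_off hH; move: hH; rewrite !inE => hH.
by apply: connect_trans hH (connect1 _); rewrite /off_rel eho hc.
Qed.

(** A connection through the component: this is the part that every crossing
    adds to the vertices of the cycle. *)
Lemma link u u' : attached u -> attached u' -> exists q h h',
  [/\ walk e h q h', e u h, e h' u' & uniq q /\ {subset q <= H}].
Proof.
move=> /exists_inP[h hH uh] /exists_inP[h' hH' uh'].
have hh : connect (off_rel e c) h h'.
  apply: (@connect_trans _ _ x); last by rewrite inE in hH'.
  by rewrite (sym_connect_sym off_rel_sym); rewrite inE in hH.
case/connectP: hh => p pp lp; case: (shortenP pp) lp => q pq uq _ lq.
exists (h :: q), h, h'; split=> //; last 1 first.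
- split=> // z zq; rewrite inE.
  apply: connect_trans (path_connect pq zq); by rewrite inE in hH.
- rewrite /= eqxx -lq eqxx andbT /=.
  by apply: sub_path pq => a b /andP[].
by rewrite es.
Qed.

(** The contradiction behind all that follows. *)
Lemma crossing s q : cycle e s -> perm_eq s (c ++ q) -> uniq q ->
  {subset q <= [predC c]} -> q != [::] -> False.
Proof.
move=> cs ps uq qc q0; case: cl => _ _ /(_ s cs).
rewrite (perm_uniq ps) (perm_size ps) cat_uniq uc uq size_cat /= andbT.
have -> : ~~ has (mem c) q.
  by apply/hasPn => z /qc.
move=> /(_ isT); rewrite -[X in _ <= X]addn0 leq_add2l leqn0 size_eq0.
by rewrite (negPf q0).
Qed.

Lemma crossing_link s q h h' : cycle e s -> perm_eq s (c ++ q) -> walk e h q h' ->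
  uniq q -> {subset q <= H} -> False.
Proof.
move=> cs ps wq uq qH; apply: (crossing cs ps uq) (walk_neq0 wq).
by move=> z /qH/component_off.
Qed.

(** Otherwise the component can be inserted between v and its predecessor. *)
Lemma label_not_attached v : label v -> ~~ attached v.
Proof.
move=> /andP[vc av]; apply/negP => av'; have [q [h [h' [wq e1 e2 [uq qH]]]]] := link av av'.
have [s0 [p0 w0]] := cut1 uc cc vc.
apply: (crossing_link _ _ wq uq qH).
  exact: walk_cycle (walk_cat w0 e1 wq) e2.
by rewrite perm_cat2r perm_sym.
Qed.

Lemma label_component v h : label v -> h \in H -> ~~ e v h.
Proof.
by move=> /label_not_attached + hH; apply: contra => vh; apply/exists_inP; exists h.
Qed.

Lemma clock_gt0 p z : p \in c -> z \in c -> p != z -> 0 < ck p z.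
Proof.
move=> pc zc; rewrite lt0n; apply: contra => /eqP h.
by apply/eqP/(clock_inj pc pc zc); rewrite clock0.
Qed.

(** An edge between two labels replaces the two cycle edges in front of them,
    and the component joins their predecessors. *)
Lemma label_indep v v' : label v -> label v' -> ~~ e v v'.
Proof.
have [<-|nv] := eqVneq v v'; first by rewrite ei.
move=> /andP[vc av] /andP[vc' av']; apply/negP => vv.
have [q [h [h' [wq e1 e2 [uq qH]]]]] := link av av'.
have [s0 [s1 [/permP pc w0 w1]]] := cut2 uc cc vc vc' (clock_gt0 vc vc' nv).
apply: (crossing_link _ _ wq uq qH).
  exact: walk_cycle (walk_cat (walk_cat (walk_rev es w0) vv w1) e1 wq) e2.
by apply/permP => a; rewrite !count_cat pc !count_cat count_rev; nat_lia.
Qed.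

(** As for [label_indep], with the vertex o in the middle of the new edge. *)
Lemma off_one_label o v v' : o \notin c -> label v -> label v' -> e v o -> e v' o -> v = v'.
Proof.
move=> oc lv lv' vo vo'; apply/eqP; apply: contraT => nv.
have oH : o \notin H by apply: contraL vo => oH; apply: label_component lv oH.
have [/andP[vc av] /andP[vc' av']] := (lv, lv').
have [q [h [h' [wq e1 e2 [uq qH]]]]] := link av av'.
have [s0 [s1 [/permP pc w0 w1]]] := cut2 uc cc vc vc' (clock_gt0 vc vc' nv).
rewrite es in vo'.
exfalso; apply: (@crossing (rev s0 ++ [:: o] ++ s1 ++ q) (q ++ [:: o])).
- exact: walk_cycle
    (walk_cat (walk_rev es w0) vo (walk_cat (walk1 e o) vo' (walk_cat w1 e1 wq))) e2.
- by apply/permP => a; rewrite !count_cat pc !count_cat count_rev; nat_lia.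
- rewrite cat_uniq uq /= orbF !andbT; apply: contra oH; exact: qH.
- by move=> z; rewrite mem_cat inE => /orP[/qH/component_off//|/eqP->].
- by case: (q).
Qed.

(** If q came after y, then the edges y p and y^- q would open the cycle between
    y^- and y, and between p, q and their predecessors, which the component
    joins. *)
Lemma cross_order y p q : y \in c -> label p -> label q -> p != q -> e y p -> e y^- q ->
  ck p q < ck p y.
Proof.
move=> yc lp lq npq yp yq; have [/andP[pc ap] /andP[qc aq]] := (lp, lq).
rewrite ltnNge; apply/negP => h.
have ny : p != y by apply: contraTneq yp => <-; rewrite ei.
have nyq : y != q by apply: contraTneq yp => ->; rewrite es label_indep.
have h1 : 0 < ck p y by apply: clock_gt0.
have h2 : ck p y < ck p q.
  by rewrite ltn_neqAle h andbT; apply: contra nyq => /eqP/(clock_inj pc yc qc)->.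
have [l [g [g' [wq e1 e2 [uq qH]]]]] := link ap aq.
have := cut3 uc cc pc yc qc; rewrite h1 => /(_ h2)[s0 [s1 [s2 [/permP pm w0 w1 w2]]]].
apply: (crossing_link _ _ wq uq qH).
  apply: walk_cycle yp.
  exact: (walk_cat w0 yq (walk_cat w2 e1 (walk_cat wq e2 (walk_rev es w1)))).
by apply/permP => a; rewrite !count_cat pm !count_cat count_rev; nat_lia.
Qed.

(** The edge between the predecessors of z and z' opens the cycle in front of
    both, the labels v and v' in front of themselves.  Of the six cyclic orders of
    z, z', v, v', four give a longer cycle; the other two are the conclusion. *)
Lemma cross_adjacent z z' v v' : z \in c -> z' \in c -> label v -> label v' -> v != v' ->
  e z v -> e z' v' -> e z^- z'^- ->
  ck z v < ck z v' < ck z z' \/ ck z z' < ck z v' < ck z v.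
Proof.
move=> zc zc' lv lv' nv zv zv' zz; have [/andP[vc av] /andP[vc' av']] := (lv, lv').
have [q [g [g' [wq e1 e2 [uq qH]]]]] := link av av'.
have nzz : z != z' by apply: contraTneq zz => ->; rewrite ei.
have nzv : z != v by apply: contraTneq zv => ->; rewrite ei.
have nzv' : z' != v' by apply: contraTneq zv' => ->; rewrite ei.
have nzv1 : z != v' by apply: contraTneq zv => ->; rewrite label_indep.
have nzv2 : z' != v by apply: contraTneq zv' => ->; rewrite label_indep.
have [[p1 p2] p3] := (clock_gt0 zc vc nzv, clock_gt0 zc vc' nzv1, clock_gt0 zc zc' nzz).
have d a b : a \in c -> b \in c -> a != b -> ck z a != ck z b.
  by move=> ac bc; apply: contra => /eqP/(clock_inj zc ac bc)->.
have d1 := d _ _ vc vc' nv.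
have d2 := d _ _ zc' vc nzv2.
have d3 := d _ _ zc' vc' nzv'.
rewrite es in zv; have vz := zv; rewrite es in zv.
have vz' : e v' z' by rewrite es.
have zz' : e z'^- z^- by rewrite es.
have fin s : cycle e s -> perm_eq s (c ++ q) -> False.
  by move=> cs ps; apply: (crossing_link cs ps wq uq qH).
have [h1|h1|h1] := ltngtP (ck z v) (ck z v'); last by rewrite h1 eqxx in d1.
- have [h2|h2|h2] := ltngtP (ck z z') (ck z v'); last by rewrite h2 eqxx in d3.
    exfalso; have [h3|h3|h3] := ltngtP (ck z z') (ck z v); last by rewrite h3 eqxx in d2.
    + have := cut4 uc cc zc zc' vc vc'; rewrite p3 => /(_ h3 h1).
      case=> [s0 [s1 [s2 [s3 [/permP pm w0 w1 w2 w3]]]]].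
      apply: (fin (s0 ++ rev s3 ++ s1 ++ q ++ rev s2)).
        exact: walk_cycle (walk_cat w0 zz' (walk_cat (walk_rev es w3) vz' 
            (walk_cat w1 e1 (walk_cat wq e2 (walk_rev es w2))))) vz.
      by apply/permP => a; rewrite !count_cat pm !count_cat !count_rev; nat_lia.
    have := cut4 uc cc zc vc zc' vc'; rewrite p1 => /(_ h3 h2).
    case=> [s0 [s1 [s2 [s3 [/permP pm w0 w1 w2 w3]]]]].
    apply: (fin (s0 ++ q ++ rev s2 ++ s3 ++ rev s1)).
      exact: walk_cycle (walk_cat w0 e1 (walk_cat wq e2 
            (walk_cat (walk_rev es w2) zv' (walk_cat w3 zz (walk_rev es w1))))) vz.
    by apply/permP => a; rewrite !count_cat pm !count_cat !count_rev; nat_lia.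
  by left.
have [h2|h2|h2] := ltngtP (ck z z') (ck z v'); last by rewrite h2 eqxx in d3.
  by right.
exfalso; have [h3|h3|h3] := ltngtP (ck z z') (ck z v); last by rewrite h3 eqxx in d2.
  have := cut4 uc cc zc vc' zc' vc; rewrite p2 => /(_ h2 h3).
  case=> [s0 [s1 [s2 [s3 [/permP pm w0 w1 w2 w3]]]]].
  have e1' : e v'^- g' by rewrite es.
  have e2' : e g v^- by rewrite es.
  apply: (fin (s0 ++ rev q ++ rev s2 ++ s1 ++ rev s3)).
    exact: walk_cycle (walk_cat w0 e1' (walk_cat (walk_rev es wq) e2' 
            (walk_cat (walk_rev es w2) zv' (walk_cat w1 zz' (walk_rev es w3))))) vz.
  by apply/permP => a; rewrite !count_cat pm !count_cat !count_rev; nat_lia.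
have := cut4 uc cc zc vc' vc zc'; rewrite p2 => /(_ h1 h3).
case=> [s0 [s1 [s2 [s3 [/permP pm w0 w1 w2 w3]]]]].
have e1' : e v'^- g' by rewrite es.
have e2' : e g v^- by rewrite es.
apply: (fin (s0 ++ rev q ++ rev s1 ++ s3 ++ rev s2)).
  exact: walk_cycle (walk_cat w0 e1' (walk_cat (walk_rev es wq) e2' 
            (walk_cat (walk_rev es w1) vz' (walk_cat w3 zz (walk_rev es w2))))) vz.
by apply/permP => a; rewrite !count_cat pm !count_cat !count_rev; nat_lia.
Qed.

(** The last three crossings use five cuts: a chord at b, one from z to one of the
    labels a, a' and the edge between the predecessors of b and z leave no room for
    a further chord at the other label. *)
Lemma ladder_left b j a a' z : b \in c -> z \in c -> label j -> label a -> label a' ->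
  0 < ck b j < ck b a -> ck b a < ck b a' < ck b z ->
  e b j -> e z a -> e b^- z^- -> ~~ e a' j^-.
Proof.
move=> bc zc lj la la' h1 h2 bj za bz; apply/negP => aj.
have [[/andP[jc aj'] /andP[ac aa]] /andP[ac' aa']] := (lj, la, la').
have [q [g [g' [wq e1 e2 [uq qH]]]]] := link aa aa'.
have [s0 [s1 [s2 [s3 [s4 [/permP pm w0 w1 w2 [w3 w4]]]]]]] :=
  cut5 uc cc bc jc ac ac' zc h1 h2.
have az' : e z^- b^- by rewrite es.
apply: (@crossing_link (rev s0 ++ s1 ++ q ++ rev s2 ++ s4 ++ rev s3) _ _ _ _ _ wq uq qH).
  rewrite es in za.
  exact: walk_cycle (walk_cat (walk_rev es w0) bj (walk_cat w1 e1 (walk_cat wq e2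
    (walk_cat (walk_rev es w2) za (walk_cat w4 bz (walk_rev es w3)))))) aj.
by apply/permP => n; rewrite !count_cat pm !count_cat !count_rev; nat_lia.
Qed.

Lemma ladder_left_eq b j a a' z : b \in c -> z \in c -> label j -> label a -> label a' ->
  0 < ck b j < ck b a -> ck b a < ck b a' < ck b z ->
  e b j -> e z a -> e b^- z^- -> ~~ e a' a^-.
Proof.
move=> bc zc lj la la' h1 h2 bj za bz; apply/negP => aj.
have [[/andP[jc aj'] /andP[ac aa]] /andP[ac' aa']] := (lj, la, la').
have [q [g [g' [wq e1 e2 [uq qH]]]]] := link aa' aj'.
have [s0 [s1 [s2 [s3 [s4 [/permP pm w0 w1 w2 [w3 w4]]]]]]] :=
  cut5 uc cc bc jc ac ac' zc h1 h2.
have az' : e z^- b^- by rewrite es.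
apply: (@crossing_link (s1 ++ s3 ++ rev s4 ++ s2 ++ q ++ rev s0) _ _ _ _ _ wq uq qH).
  rewrite es in aj.
  exact: walk_cycle (walk_cat w1 aj (walk_cat w3 az' (walk_cat (walk_rev es w4) za
    (walk_cat w2 e1 (walk_cat wq e2 (walk_rev es w0)))))) bj.
by apply/permP => n; rewrite !count_cat pm !count_cat !count_rev; nat_lia.
Qed.

Lemma ladder_right b z a a' y : b \in c -> z \in c -> y \in c -> label a -> label a' ->
  0 < ck b z < ck b a -> ck b a < ck b a' < ck b y ->
  e b y^- -> e z a' -> e b^- z^- -> ~~ e a y.
Proof.
move=> bc zc yc la la' h1 h2 byy za bz; apply/negP => ay.
have [/andP[ac aa] /andP[ac' aa']] := (la, la').
have [q [g [g' [wq e1 e2 [uq qH]]]]] := link aa aa'.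
have [s0 [s1 [s2 [s3 [s4 [/permP pm w0 w1 w2 [w3 w4]]]]]]] :=
  cut5 uc cc bc zc ac ac' yc h1 h2.
apply: (@crossing_link (rev s3 ++ s1 ++ q ++ rev s2 ++ s4 ++ rev s0) _ _ _ _ _ wq uq qH).
  rewrite es in za.
  exact: walk_cycle (walk_cat (walk_rev es w3) za (walk_cat w1 e1 (walk_cat wq e2
    (walk_cat (walk_rev es w2) ay (walk_cat w4 bz (walk_rev es w0)))))) byy.
by apply/permP => n; rewrite !count_cat pm !count_cat !count_rev; nat_lia.
Qed.

(** The chord from the successor of v to v' allows the two neighbours x has in
    front of v and of v' to be joined through x, at the price of v only; the new
    cycle has the same length. *)
Lemma swap_vertex v v' : v \in c -> v' \in c -> v != v' -> e x v^- -> e x v'^- ->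
  e (next c v) v' -> exists2 c', longest e c' & v \notin c' /\
    forall z, z \in c -> z != v -> z \in c'.
Proof.
move=> vc vc' nv xv xv' nvv; set w := next c v in nvv *.
have wc : w \in c by rewrite mem_next.
have nwv : w != v' by apply: contraTneq nvv => ->; rewrite ei.
have lt : 0 < ck v v' by apply: clock_gt0.
have lt' := clock_lt vc vc'.
have cw : ck v w = 1 by rewrite clock_next ?clock0 //; nat_lia.
have h : 0 < ck v w < ck v v'.
  rewrite cw /= ltn_neqAle lt andbT -cw; apply: contra nwv => /eqP.
  by move/(clock_inj vc wc vc')/eqP.
have [s0 [s1 [s2 [pm w0 w1 w2]]]] := cut3 uc cc vc wc vc' h.
rewrite prev_next // in w0.
have us : uniq (s0 ++ s1 ++ s2) by rewrite -(perm_uniq pm).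
have E0 : s0 = [:: v].
  case: s0 w0 us {pm} => // a t /= /and3P[/eqP-> _ /eqP lt0] /andP[+ _].
  case: t lt0 => // a' t lt0; rewrite mem_cat -[in X in X -> _]lt0 /=.
  by rewrite mem_last.
rewrite {}E0 in pm us w0.
have {}pm' : perm_eq (x :: c) (v :: s2 ++ [:: x] ++ rev s1).
  apply/permP => a; rewrite /= (permP pm) /= !count_cat /= count_rev; nat_lia.
have uxc : uniq (x :: c) by rewrite /= xc.
have := uxc; rewrite (perm_uniq pm') /= => /andP[vc'' uc''].
have xv'' : e v^- x by rewrite es.
exists (s2 ++ [:: x] ++ rev s1); split=> //.
- exact: walk_cycle (walk_cat w2 xv'' (walk_cat (walk1 e x) xv' (walk_rev es w1))) nvv.
- move=> d cd ud; have [_ _ /(_ d cd ud)] := cl.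
  by have /perm_size := pm'; rewrite /= => -[<-].
move=> z zc nz; have := perm_mem pm' z; rewrite !inE (negPf nz) zc orbT /=.
by rewrite mem_cat => <-.
Qed.

End Crossing.

(** * Degree sums over sets of labels *)

Section Basics.
Variables (T : finType) (e : rel T).

Lemma independentP (X : {set T}) :
  reflect {in X &, forall u v, ~~ e u v} (independent e X).
Proof.
apply: (iffP forall_inP) => [h u v uX vX|h u uX].
  exact: (forall_inP (h u uX)).
by apply/forall_inP => v vX; apply: h.
Qed.

Lemma independent_alpha (X : {set T}) : independent e X -> #|X| <= alpha e.
Proof. by move=> iX; apply: (leq_bigmax_cond X iX). Qed.

Lemma card_indicator (A : {set T}) : #|A| = \sum_z (z \in A : nat).
Proof. by rewrite -sum1_card big_mkcond /=; apply: eq_bigr => z _; case: ifP. Qed.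

Lemma card_le_bool (A : {set T}) (r : bool) :
  {in A &, forall u v, u = v} -> (forall u, u \in A -> r) -> #|A| <= r.
Proof.
move=> h hr; case: (set_0Vmem A) => [->|[u uA]]; first by rewrite cards0.
rewrite (hr u uA) /=; by apply/card_le1_eqP => a b aA bA; apply: h.
Qed.

Lemma degree_sum (Y : {set T}) : symmetric e ->
  \sum_(y in Y) degree e y = \sum_z #|[set y in Y | e z y]|.
Proof.
move=> es; under eq_bigr do rewrite /degree card_indicator.
rewrite exchange_big; apply: eq_bigr => z _; rewrite card_indicator big_mkcond /=.
by apply: eq_bigr => y _; rewrite !inE es; case: (y \in Y).
Qed.

End Basics.

Section Between.
Variables (T : finType) (e : rel T) (c : seq T) (Y : {set T}) (y1 : T).

Definition last_from := [arg max_(y > y1 in Y) clock c y1 y].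

(** The neighbours z of p for which p is not the farthest neighbour of z in Y in
    its direction, when the cycle is read from y1. *)
Definition between p := [set z in c | e z p && [exists y in Y, e z y &&
  ((clock c y1 z < clock c y1 p < clock c y1 y) ||
   (clock c y1 y < clock c y1 p < clock c y1 z))]].

(** z pays for its last neighbour in Y to its right, and [leftward] for its first
    neighbour to its left.  Beyond the last vertex of Y everything is to the left;
    there the two units are for the last vertex of Y and for the others. *)
Definition rightward z :=
  if clock c y1 z < clock c y1 last_from then
    [exists y in Y, e z y && (clock c y1 z < clock c y1 y)]
  else [exists y in Y, (y != last_from) && e z y].

Definition leftward z :=
  if clock c y1 z < clock c y1 last_from then
    [exists y in Y, e z y && (clock c y1 y < clock c y1 z)]
  else e z last_from.

End Between.

Section Between.
Variables (T : finType) (e : rel T) (c : seq T) (x : T).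
Hypotheses (es : symmetric e) (ei : irreflexive e) (cl : longest e c) (xc : x \notin c).
Let cc : cycle e c. Proof. by case: cl. Qed.
Let uc : uniq c. Proof. by case: cl. Qed.
Variables (Y : {set T}) (y1 : T).
Hypotheses (lY : {in Y, forall y, label e c x y}) (y1Y : y1 \in Y) (Y2 : 1 < #|Y|).
Local Notation H := (component e c x).
Local Notation idx := (clock c y1).
Local Notation top := (last_from c Y y1).
Local Notation betw := (between e c Y y1).
Local Notation rgt := (rightward e c Y y1).
Local Notation lft := (leftward e c Y y1).

Let Yc y : y \in Y -> y \in c. Proof. by case/lY/andP. Qed.
Let y1c : y1 \in c. Proof. exact: Yc. Qed.

Lemma last_from_mem : top \in Y.
Proof. by rewrite /last_from; case: arg_maxnP. Qed.

Lemma last_from_max y : y \in Y -> idx y <= idx top.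
Proof. by rewrite /last_from; case: arg_maxnP => // i iY; apply. Qed.

Lemma idx_inj u v : u \in c -> v \in c -> idx u = idx v -> u = v.
Proof. exact: clock_inj. Qed.

Lemma last_from_gt0 : 0 < idx top.
Proof.
have /card_gt1P[u [v [uY vY nuv]]] := Y2.
have [ut vt] := (last_from_max uY, last_from_max vY).
rewrite lt0n; apply: contra nuv => /eqP t0.
by apply/eqP/idx_inj; rewrite ?Yc //; nat_lia.
Qed.

Lemma idx_prev z : z \in c -> 0 < idx z -> idx (prev c z) = (idx z).-1.
Proof. exact: clock_prev_pos. Qed.

(** Both payments would be two chords, from z and from its predecessor, in the
    order that [cross_order] forbids. *)
Lemma left_right_disjoint z : z \in c -> lft z -> rgt (prev c z) -> False.
Proof.
move=> zc; have tg := last_from_gt0; have tc := Yc last_from_mem.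
have pzc : prev c z \in c by rewrite mem_prev.
have sz := clock_lt y1c tc.
have order := cross_order es ei cl xc zc.
have base := clock_base y1c.
rewrite /leftward; case: ltnP => ht.
  case/exists_inP => p pY /andP[zp hp].
  rewrite /rightward idx_prev // ; last by nat_lia.
  case: ifP; last by nat_lia.
  move=> _ /exists_inP[q qY /andP[zq hq]].
  have npq : p != q by apply: contraTneq hp => ->; nat_lia.
  have := order _ _ (lY pY) (lY qY) npq zp zq.
  rewrite (base _ _ (Yc pY) (Yc qY)) (base _ _ (Yc pY) zc).
  by case_ifs; nat_lia.
move=> zt; have nzt : z != top by apply: contraTneq zt => ->; rewrite ei.
have lt : idx top < idx z.
  by rewrite ltn_neqAle ht andbT; apply: contra nzt => /eqP/(idx_inj tc zc)->.
rewrite /rightward idx_prev //; last by nat_lia.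
case: ifP; first by nat_lia.
move=> _ /exists_inP[q qY /andP[nqt zq]]; have qt := last_from_max qY.
have lt' : idx q < idx top.
  by rewrite ltn_neqAle qt andbT; apply: contra nqt => /eqP/(idx_inj (Yc qY) tc)->.
rewrite eq_sym in nqt.
have := order _ _ (lY last_from_mem) (lY qY) nqt zt zq; have := clock_lt y1c zc.
rewrite (base _ _ tc (Yc qY)) (base _ _ tc zc).
by case_ifs; nat_lia.
Qed.

(** A neighbour p of z in Y that z does not pay for has another neighbour of z
    beyond it, on the same side of z; so at most one element per side escapes
    [between]. *)
Lemma nbrs_le z : z \in c ->
  #|[set y in Y | e z y]| <=
  lft z + rgt z + \sum_(p in Y | (p != y1) && (p != top)) (z \in betw p).
Proof.
move=> zc; set F := [set y in Y | e z y].
have Fi p : p \in F -> [/\ p \in Y, e z p, p \in c & idx p != idx z].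
  rewrite inE => /andP[pY zp]; split; rewrite ?Yc //.
  by apply: contraTneq zp => /(idx_inj (Yc pY) zc) ->; rewrite ei.
pose M := [set p in F | (p != y1) && (p != top) && (z \in betw p)].
have -> : \sum_(p in Y | (p != y1) && (p != top)) (z \in betw p) = #|M|.
  rewrite -sum1_card big_mkcond [RHS]big_mkcond; apply: eq_bigr => p _ /=.
  rewrite !inE; case: (p \in Y) => //=; case: ifP => //=; last by rewrite andbF.
  by case: (e z p) => //=; rewrite ?andbF //; case: ifP => ->.
have MF : M \subset F by apply/subsetP => p; rewrite inE => /andP[].
rewrite -(cardsID M F) (setIidPr MF) addnC leq_add2r.
set G := F :\: M.
have GF p : p \in G -> p \in F by rewrite inE => /andP[].
have GK p p' : p \in G -> p' \in F -> p != y1 -> p != top ->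
   (idx z < idx p < idx p') || (idx p' < idx p < idx z) -> False.
  rewrite !inE -!andbA => /andP[+ /andP[pY zp]] /andP[p'Y zp'] n1 n2 h.
  rewrite pY zp n1 n2 zc /= => /negP; apply.
  by apply/exists_inP; exists p' => //; rewrite zp' h.
have y1idx p : 0 < idx p -> p != y1 by apply: contraTneq => ->; rewrite clock0.
have topidx p : idx p < idx top -> p != top by apply: contraTneq => ->; rewrite ltnn.
have [ht|ht] := ltnP (idx z) (idx top).
  rewrite -(cardsID [set p | idx p < idx z] G); apply: leq_add; apply: card_le_bool.
  - move=> p p' /setIP[pG +] /setIP[p'G +]; rewrite !in_set => pz p'z.
    have [[pY zp pc _] [p'Y zp' p'c _]] := (Fi p (GF _ pG), Fi p' (GF _ p'G)).
    case: (ltngtP (idx p) (idx p')) => [h|h|/idx_inj->//].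
      case: (GK p' p) => //; [exact: GF|apply: y1idx; nat_lia|apply: topidx; nat_lia|].
      by apply/orP; right; apply/andP.
    case: (GK p p') => //; [exact: GF|apply: y1idx; nat_lia|apply: topidx; nat_lia|].
    by apply/orP; right; apply/andP.
  - move=> p /setIP[/GF/Fi[pY zp _ _]]; rewrite in_set => pz.
    by rewrite /leftward ht; apply/exists_inP; exists p; rewrite ?zp.
  - move=> p p' /setDP[pG +] /setDP[p'G +]; rewrite !in_set -!leqNgt => pz p'z.
    have [[pY zp pc pn] [p'Y zp' p'c p'n]] := (Fi p (GF _ pG), Fi p' (GF _ p'G)).
    rewrite eq_sym in pn; rewrite eq_sym in p'n.
    have {}pz : idx z < idx p by rewrite ltn_neqAle pn.
    have {}p'z : idx z < idx p' by rewrite ltn_neqAle p'n.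
    have [pt p't] := (last_from_max pY, last_from_max p'Y).
    case: (ltngtP (idx p) (idx p')) => [h|h|/idx_inj->//].
      case: (GK p p') => //; [exact: GF|apply: y1idx; nat_lia|apply: topidx; nat_lia|].
      by apply/orP; left; apply/andP.
    case: (GK p' p) => //; [exact: GF|apply: y1idx; nat_lia|apply: topidx; nat_lia|].
    by apply/orP; left; apply/andP.
  - move=> p /setDP[/GF/Fi[pY zp _ pn]]; rewrite in_set => pz.
    rewrite /rightward ht; apply/exists_inP; exists p; rewrite ?zp //.
    by rewrite ltn_neqAle eq_sym pn leqNgt.
rewrite -(cardsID [set top] G); apply: leq_add; apply: card_le_bool.
- by move=> p p' /setIP[_ /set1P->] /setIP[_ /set1P->].
- move=> p /setIP[/GF/Fi[pY zp _ _] /set1P pt].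
  by rewrite /leftward ltnNge ht -pt.
- move=> p p' /setDP[pG +] /setDP[p'G +]; rewrite !in_set1 => pt p't.
  have [[pY zp pc pn] [p'Y zp' p'c p'n]] := (Fi p (GF _ pG), Fi p' (GF _ p'G)).
  have {}pz : idx p < idx z.
    by rewrite ltn_neqAle pn; have := last_from_max pY; nat_lia.
  have {}p'z : idx p' < idx z.
    by rewrite ltn_neqAle p'n; have := last_from_max p'Y; nat_lia.
  case: (ltngtP (idx p) (idx p')) => [h|h|/idx_inj->//].
    case: (GK p' p) => //; [exact: GF|apply: y1idx; nat_lia|].
    by apply/orP; right; apply/andP.
  case: (GK p p') => //; [exact: GF|apply: y1idx; nat_lia|].
  by apply/orP; right; apply/andP.
- move=> p /setDP[/GF/Fi[pY zp _ pn]]; rewrite in_set1 => pt.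
  by rewrite /rightward ltnNge ht; apply/exists_inP; exists p; rewrite ?pt.
Qed.

(** Double counting of the edges at Y.  U collects vertices which pay nothing:
    vertices u of the cycle without rightward payment and with successor without
    leftward payment, and vertices off the cycle seeing no element of Y. *)
Lemma label_degree_sum (U : {set T}) :
  {in U, forall u, u \in c -> ~~ rgt u && ~~ lft (next c u)} ->
  {in U, forall u, u \notin c -> (u \notin H) /\ {in Y, forall y, ~~ e u y}} ->
  \sum_(y in Y) degree e y + #|U| + #|H| <=
    #|T| + \sum_(p in Y | (p != y1) && (p != top)) #|betw p|.
Proof.
move=> Uc Uo; rewrite (degree_sum _ es).
have Ho h : h \in H -> h \notin c by apply: component_off.
(* Off the cycle a vertex sees at most one label, and none if it lies in H. *)
pose A1 := [set z | [&& z \notin c, z \notin H & z \notin U]].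
pose A2 := [set z in c | lft z].
pose A3 := [set z in c | rgt z].
apply: (@leq_trans (\sum_z ((z \in A1) + (z \in A2) + (z \in A3) +
   \sum_(p in Y | (p != y1) && (p != top)) (z \in betw p)) + #|U| + #|H|)).
  rewrite !leq_add2r; apply: leq_sum => z _; rewrite !(in_set, inE).
  have [zc|zc] := boolP (z \in c); first by rewrite /= add0n; apply: nbrs_le.
  rewrite /= !addn0; apply: leq_trans (leq_addr _ _).
  apply: card_le_bool => [p p'|p]; rewrite !in_set => /andP[pY zp].
    move=> /andP[p'Y zp']; rewrite es in zp; rewrite es in zp'.
    exact: (off_one_label es cl xc zc (lY pY) (lY p'Y) zp zp').
  apply/andP; split.
    apply: contraL zp => zH; rewrite es.
    by apply: (label_component es cl xc (lY pY)); rewrite inE.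
  by apply: contraL zp => zU; have [_ /(_ p pY)] := Uo z zU zc.
rewrite !big_split /= -!card_indicator [X in _ + X + _ + _]exchange_big /=.
under [X in _ + X + _ + _]eq_bigr do rewrite -card_indicator.
(* After the shift to the predecessor the leftward payers are disjoint from the
   rightward ones. *)
have -> : #|A2| = #|[set z in c | lft (next c z)]|.
  rewrite -(card_imset _ (@prev_inj _ c uc)); apply: eq_card => z; rewrite inE.
  apply/imsetP/andP => [[w]|[zc lz]].
    by rewrite inE => /andP[wc lw] ->; rewrite mem_prev next_prev.
  by exists (next c z); rewrite ?inE ?mem_next ?zc ?lz ?prev_next.
set A2' := [set z in c | _]; set S := \sum_(p in Y | _) _.
suff : #|A1| + #|A2'| + #|A3| + #|U| + #|H| <= #|T|.
  by rewrite (addnAC _ S) (addnAC _ S) leq_add2r.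
rewrite !card_indicator -!big_split /= -sum1_card; apply: leq_sum => z _.
have [zc|zc] := boolP (z \in c).
  have -> : z \in H = false by apply/negP => /Ho; rewrite zc.
  have -> : z \in A1 = false by rewrite in_set zc.
  have E2 : (z \in A2') = lft (next c z) by rewrite in_set zc.
  have E3 : (z \in A3) = rgt z by rewrite in_set zc.
  rewrite E2 E3; have [zU|zU] := boolP (z \in U).
    by have /andP[/negbTE-> /negbTE->] := Uc z zU zc.
  case: (boolP (lft _)) => [l|//]; last by case: (rgt z).
  case: (boolP (rgt z)) => // r; have nzc : next c z \in c by rewrite mem_next.
  by case: (left_right_disjoint nzc l); rewrite prev_next.
have -> : z \in A2' = false by rewrite in_set (negPf zc).
have -> : z \in A3 = false by rewrite in_set (negPf zc).
rewrite in_set zc; have [zU|zU] := boolP (z \in U); last by case: (z \in H).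
by have [/negbTE-> _] := Uo z zU zc; rewrite andbF.
Qed.

(** Two such vertices z, z' with adjacent predecessors, together with p and the
    elements of Y beyond it, would be in a cyclic order excluded by
    [cross_adjacent]. *)
Lemma between_indep p : p \in Y ->
  independent e (x |: [set prev c z | z in betw p]) /\
  #|x |: [set prev c z | z in betw p]| = #|betw p|.+1.
Proof.
move=> pY; have pc := Yc pY; have lp := lY pY; split; last first.
  rewrite cardsU1 (card_imset _ (@prev_inj _ c uc)).
  suff -> : x \notin [set prev c z | z in betw p] by [].
  apply: contra xc => /imsetP[z + ->]; rewrite mem_prev.
  by rewrite inE => /andP[->].
have nx z : z \in betw p -> ~~ e (prev c z) x.
  rewrite inE => /and3P[zc zp _]; apply: contraL zp => zx.
  apply: (label_indep es ei cl xc) lp; rewrite /label zc; apply/exists_inP; exists x => //.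
  exact: component_self.
have base z b := @clock_base _ c y1 z b y1c.
have key z z' : z \in betw p -> z' \in betw p -> idx z < idx z' ->
    ~~ e (prev c z) (prev c z').
  rewrite !in_set => /and3P[zc zp /exists_inP[y yY /andP[zy hy]]].
  move=> /and3P[z'c z'p /exists_inP[y' y'Y /andP[z'y' hy']]] lt; apply/negP => zz.
  have [yc y'c] := (Yc yY, Yc y'Y).
  have sy := clock_lt y1c yc.
  have sy' := clock_lt y1c y'c.
  have sp := clock_lt y1c pc.
  have sz := clock_lt y1c zc.
  have sz' := clock_lt y1c z'c.
  have adj := cross_adjacent es ei cl xc zc z'c.
  have npy : y != p by apply: contraTneq hy => ->; rewrite !ltnn andbF.
  have npy' : p != y' by apply: contraTneq hy' => <-; rewrite !ltnn andbF.
  case/orP: hy => /andP[h1 h2].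
    have := adj _ _ lp (lY y'Y) npy' zp z'y' zz.
    rewrite (base _ _ zc pc) (base _ _ zc y'c) (base _ _ zc z'c).
    by case/orP: hy' => /andP[h3 h4]; case_ifs; nat_lia.
  case/orP: hy' => /andP[h3 h4].
    by nat_lia.
  have := adj _ _ (lY yY) lp npy zy z'p zz.
  rewrite (base _ _ zc pc) (base _ _ zc yc) (base _ _ zc z'c).
  by case_ifs; nat_lia.
apply/independentP => u v; rewrite !in_setU1.
case/predU1P => [->|/imsetP[z zb ->]]; case/predU1P => [->|/imsetP[z' zb' ->]].
- by rewrite ei.
- by rewrite es nx.
- exact: nx.
have zc : z \in c by move: zb; rewrite inE => /andP[].
have zc' : z' \in c by move: zb'; rewrite inE => /andP[].
case: (ltngtP (idx z) (idx z')) => [h|h|/(idx_inj zc zc')->]; last by rewrite ei.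
  exact: key.
by rewrite es key.
Qed.

End Between.

(** * Menger's theorem *)

Section Menger.
Variable T : finType.
Implicit Types (G : rel T) (A B S : {set T}).

(** Stated by reachability outside S, which makes it decidable; [separatesP] gives
    the formulation by walks. *)
Definition separates G A B S :=
  [forall a in A, forall b in B, ~~ [&& a \notin S, b \notin S &
     connect (fun u v => [&& G u v, u \notin S & v \notin S]) a b]].

Lemma separatesP G A B S :
  reflect (forall a s b, a \in A -> b \in B -> walk G a s b -> exists2 z, z \in s & z \in S)
    (separates G A B S).
Proof.
apply: (iffP forall_inP) => [h a s b aA bB ws|h a aA].
  have [/hasP //|/hasPn ns] := boolP (has (mem S) s).
  have := forall_inP (h a aA) b bB.
  rewrite (ns _ (walk_head ws)) (ns _ (walk_last ws)) /= => /negP; case.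
  case: s ws ns => // z t /and3P[/eqP-> pt /eqP<-] ns.
  apply/connectP; exists t => //.
  elim: t a {aA bB z} pt ns => //= z t IH a /andP[az pt] ns.
  rewrite az /= (ns a) ?mem_head // (ns z) ?inE ?eqxx ?orbT //=.
  by apply: IH => // w wt; apply: ns; rewrite inE wt orbT.
apply/forall_inP => b bB; apply/negP => /and3P[aS bS /connectP[t pt bE]].
have ws : walk G a (a :: t) b.
  by rewrite /= eqxx bE eqxx andbT /=; apply: sub_path pt => u v /andP[].
have [z + zS] := h _ _ _ aA bB ws.
have := pt => {pt ws bE}; elim: t a aS {aA} => [|w t IH] a aS /=.
  by rewrite inE => _ /eqP za; rewrite -za zS in aS.
case/andP => /and3P[_ _ wS] pt; rewrite inE => /predU1P[za|]; last exact: IH pt.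
by rewrite -za zS in aS.
Qed.

(** n disjoint paths from A to B.  A path may have a single vertex, so A and B
    need not be disjoint. *)
Definition linked G A B n :=
  exists (f : 'I_n -> seq T) (s t : 'I_n -> T),
    (forall i, [/\ s i \in A, t i \in B, walk G (s i) (f i) (t i) & uniq (f i)]) /\
    (forall i j z, z \in f i -> z \in f j -> i = j).

Lemma linked_shorten G A B n (f : 'I_n -> seq T) (s t : 'I_n -> T) :
  (forall i, [/\ s i \in A, t i \in B & walk G (s i) (f i) (t i)]) ->
  (forall i j z, z \in f i -> z \in f j -> i = j) -> linked G A B n.
Proof.
move=> h d.
have /fin_all_exists2 [g gw gu] i :
    exists2 g, walk G (s i) g (t i) & uniq g /\ {subset g <= f i}.
  by have [_ _ /walk_uniq] := h i.
exists g, s, t; split=> [i|i j z zi zj]; first by have [? ? _] := h i; have [? _] := gu i.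
by apply: (d i j z); [have [_ ->] := gu i | have [_ ->] := gu j].
Qed.

Lemma sub_walk G G' x s y : {in s &, subrel G G'} -> walk G x s y -> walk G' x s y.
Proof.
case: s => // z t sub /and3P[zx pt lt]; rewrite /= zx lt andbT /=.
by apply: (sub_in_path sub) pt; apply/allP.
Qed.

Lemma walk_cut G x s1 z s2 y : walk G x (s1 ++ z :: s2) y ->
  walk G x (rcons s1 z) z /\ walk G z (z :: s2) y.
Proof.
case: s1 => [|a s1] /=; first by case/and3P => /eqP-> p /eqP<-; rewrite !eqxx p.
rewrite cat_path last_cat /= => /and3P[/eqP-> /and3P[p1 ez p2] /eqP<-].
by rewrite !eqxx rcons_path p1 ez last_rcons eqxx p2.
Qed.

Lemma has_first (a : pred T) s : has a s ->
  exists s1 z s2, [/\ s = s1 ++ z :: s2, a z & ~~ has a s1].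
Proof. by case/split_find => z s1 s2 az h; exists s1, z, s2; rewrite cat_rcons. Qed.

Lemma has_last (a : pred T) s : has a s ->
  exists s1 z s2, [/\ s = s1 ++ z :: s2, a z & ~~ has a s2].
Proof.
rewrite -has_rev => /has_first[s1 [z [s2 [E az h]]]].
exists (rev s2), z, (rev s1); rewrite has_rev; split=> //.
by rewrite -[s]revK E rev_cat rev_cons cat_rcons.
Qed.

(** Menger's theorem between two sets in a directed graph, by induction on the
    number of edges.  If deleting the edge x y creates a separator S with fewer
    than n vertices, then S + x and S + y have exactly n vertices and, in the
    smaller graph, cannot be separated from A, respectively B, by fewer than n
    vertices.  The paths obtained by induction meet only in S, and are joined there
    and along the edge x y. *)
Lemma menger G A B n : (forall S, separates G A B S -> n <= #|S|) -> linked G A B n.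
Proof.
move: {2}#|_| (leqnn #|[set uv : T * T | G uv.1 uv.2]|) => m.
elim: m G A B n => [|m IH] G A B n.
  rewrite leqn0 cards_eq0 => /eqP G0 h.
  have nG u v : G u v = false.
    by have := in_set0 (u, v); rewrite -G0 inE.
  have hAB : n <= #|A :&: B|.
    apply: h; apply/separatesP => a s b aA bB.
    case: s => // z [|w t] /=; last by rewrite nG andbF.
    by case/andP => /eqP-> /eqP ab; exists a; rewrite ?mem_head // inE aA ab.
  pose f (i : 'I_n) := enum_val (widen_ord hAB i).
  have fAB i : f i \in A :&: B by apply: enum_valP.
  exists (fun i => [:: f i]), f, f; split=> [i|i j z].
    by have := fAB i; rewrite inE => /andP[? ?]; rewrite /= !eqxx.
  rewrite !inE => /eqP-> /eqP/enum_val_inj E; apply: val_inj.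
  exact: (congr1 val E).
move=> Gm hS; have [[x y]|] := pickP [pred uv : T * T | G uv.1 uv.2]; last first.
  move=> G0; apply: IH hS; rewrite (_ : [set _ | _] = set0) ?cards0 //.
  by apply/setP => uv; rewrite !inE; apply: G0.
rewrite /= => Gxy; pose G' := [rel u v | G u v && ((u, v) != (x, y))].
have G'm : #|[set uv : T * T | G' uv.1 uv.2]| <= m.
  rewrite -ltnS; apply: leq_trans Gm; apply: proper_card; apply/properP; split.
    by apply/subsetP => -[u v]; rewrite !inE => /andP[].
  by exists (x, y); rewrite !inE //= eqxx andbF.
have subG : subrel G' G by move=> u v /andP[].
have [/existsP[S /andP[sepS nS]]|] :=
    boolP [exists S : {set T}, separates G' A B S && (#|S| < n)]; last first.
  rewrite negb_exists => /forallP nS.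
  have [S sS|f [s [t [h d]]]] := IH G' A B n G'm.
    by have := nS S; rewrite sS /= -leqNgt.
  exists f, s, t; split=> // i; have [? ? w ?] := h i; split=> //.
  by apply: sub_walk w => u v _ _; apply: subG.
(* A walk of G is a walk of G' if it does not leave x, or does not enter y; for a
   walk ending in x, or beginning in y, the last or first vertex does not matter. *)
have walkx p s q : ~~ has (pred1 x) s -> walk G p s q -> walk G' p s q.
  move=> /hasPn nx; apply: sub_walk => u v us vs Guv; rewrite /= Guv /=.
  by apply: contra (nx u us); rewrite xpair_eqE => /andP[].
have walkx' p s z : ~~ has (pred1 x) s -> walk G p (rcons s z) z -> walk G' p (rcons s z) z.
  case: s => [|a s] //= nx; rewrite !rcons_path => /and3P[-> /andP[ps lz] ->].
  rewrite andbT /=.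
  have [/negbTE ax nxs] : a != x /\ ~~ has (pred1 x) s by apply/andP; rewrite -negb_or.
  have nlx : last a s != x.
    by apply: contra nx => /eqP<-; rewrite -[_ || _]/(has _ (a :: s)) has_pred1 mem_last.
  rewrite lz xpair_eqE (negPf nlx) /= andbT.
  have sub : {in a :: s &, subrel G G'}.
    move=> u v us _ Guv; rewrite /= Guv xpair_eqE negb_and; apply/orP; left.
    by apply: contra nx => /eqP <-; rewrite -[_ || _]/(has _ (a :: s)) has_pred1.
  by apply: (sub_in_path sub) ps; apply/allP.
have walky' z s q : ~~ has (pred1 y) s -> walk G z (z :: s) q -> walk G' z (z :: s) q.
  move=> ny /= /and3P[-> ps ->]; rewrite andbT /=.
  elim: s z ps ny => //= a s IHs z /andP[-> ps]; rewrite negb_or => /andP[ay ny].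
  by rewrite xpair_eqE (negPf ay) andbF /= IHs.
have walky p s q : ~~ has (pred1 y) s -> walk G p s q -> walk G' p s q.
  move=> /hasPn ny; apply: sub_walk => u v us vs Guv; rewrite /= Guv /=.
  by apply: contra (ny v vs); rewrite xpair_eqE => /andP[].
have hP : separates G A B (x |: S).
  apply/separatesP => a s b aA bB ws; have [xs|nx] := boolP (has (pred1 x) s).
    by exists x; rewrite ?setU11 // -has_pred1.
  have [z zs zS] := separatesP _ _ _ _ sepS a s b aA bB (walkx _ _ _ nx ws).
  by exists z; rewrite // inE zS orbT.
have hQ : separates G A B (y |: S).
  apply/separatesP => a s b aA bB ws; have [ys|ny] := boolP (has (pred1 y) s).
    by exists y; rewrite ?setU11 // -has_pred1.
  have [z zs zS] := separatesP _ _ _ _ sepS a s b aA bB (walky _ _ _ ny ws).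
  by exists z; rewrite // inE zS orbT.
have [nP nQ] := (hS _ hP, hS _ hQ).
have xS : x \notin S.
  by apply: contraL nS => xS; rewrite -leqNgt; move: nP; rewrite cardsU1 xS.
have yS : y \notin S.
  by apply: contraL nS => yS; rewrite -leqNgt; move: nQ; rewrite cardsU1 yS.
have cS : #|S|.+1 = n by move: nP nS; rewrite cardsU1 xS; nat_lia.
have cP : #|x |: S| = n by rewrite cardsU1 xS.
have cQ : #|y |: S| = n by rewrite cardsU1 yS.
have [Z sZ|f [fs [p [fh fd]]]] := IH G' A (x |: S) n G'm.
  apply: hS; apply/separatesP => a s b aA bB ws.
  have /has_first[s1 [z [s2 [E zP nP1]]]] : has (mem (x |: S)) s.
    by apply/hasP; have [z ? ?] := separatesP _ _ _ _ hP _ _ _ aA bB ws; exists z.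
  rewrite E in ws; have [w1 _] := walk_cut ws.
  have [|w ws1 wZ] := separatesP _ _ _ _ sZ a (rcons s1 z) z aA zP.
    apply: walkx' w1; apply: contra nP1 => /hasP[u us /eqP ux]; apply/hasP.
    by exists u => //; rewrite ux /= setU11.
  exists w => //; rewrite E mem_cat; move: ws1.
  by rewrite mem_rcons !inE => /orP[->|->]; rewrite ?orbT.
have [Z sZ|g [q [gt [gh gd]]]] := IH G' (y |: S) B n G'm.
  apply: hS; apply/separatesP => a s b aA bB ws.
  have /has_last[s1 [z [s2 [E zQ nQ1]]]] : has (mem (y |: S)) s.
    by apply/hasP; have [z ? ?] := separatesP _ _ _ _ hQ _ _ _ aA bB ws; exists z.
  rewrite E in ws; have [_ w1] := walk_cut ws.
  have [|w ws1 wZ] := separatesP _ _ _ _ sZ z (z :: s2) b zQ bB.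
    apply: walky' w1; apply: contra nQ1 => /hasP[u us /eqP ux]; apply/hasP.
    by exists u => //; rewrite ux /= setU11.
  by exists w => //; rewrite E mem_cat ws1 orbT.
have injP : injective p.
  move=> i j pij; apply: (fd i j (p i)); first by have [_ _ /walk_last] := fh i.
  by rewrite pij; have [_ _ /walk_last] := fh j.
have injQ : injective q.
  move=> i j pij; apply: (gd i j (q i)); first by have [_ _ /walk_head] := gh i.
  by rewrite pij; have [_ _ /walk_head] := gh j.
have onto (r : 'I_n -> T) (R : {set T}) :
    injective r -> (forall i, r i \in R) -> #|R| = n ->
    forall z, z \in R -> exists i, r i = z.
  move=> ir rR cR z; have -> : R = [set r i | i in setT].
    apply/esym/eqP; rewrite eqEcard card_imset // cardsT card_ord cR leqnn andbT.
    by apply/subsetP => _ /imsetP[i _ ->].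
  by case/imsetP => i _ ->; exists i.
have ontoP z : z \in x |: S -> exists i, p i = z.
  by apply: onto => // i; have [] := fh i.
have ontoQ z : z \in y |: S -> exists i, q i = z.
  by apply: onto => // i; have [] := gh i.
(* The start of the path that continues the i-th one. *)
pose q' i := if p i == x then y else p i.
have /fin_all_exists[j qj] i : exists j, q j = q' i.
  apply: ontoQ; rewrite /q'; case: eqP => [_|/eqP ne]; first by rewrite setU11.
  have [_ pP _ _] := fh i; move: pP; rewrite !inE (negPf ne) /= => ->.
  by rewrite orbT.
have meet i k z : z \in f i -> z \in g k -> [/\ z \in S, z = p i & z = q k].
  move=> zf zg; have [sA pP wf uf] := fh i; have [qQ tB wg ug] := gh k.
  have fend w : w \in f i -> w \in S -> w = p i.
    move=> wfi wS; have [|i' pi'] := ontoP w; first by rewrite inE wS orbT.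
    rewrite -pi' (fd i i' w) // -pi'; by have [_ _ /walk_last] := fh i'.
  have gend w : w \in g k -> w \in S -> w = q k.
    move=> wgk wS; have [|i' pi'] := ontoQ w; first by rewrite inE wS orbT.
    rewrite -pi' (gd k i' w) // -pi'; by have [_ _ /walk_head] := gh i'.
  have [f1 [f2 [fE wf2 wf1]]] := walk_split wf zf.
  have [g1 [g2 [gE wg2 wg1]]] := walk_split wg zg.
  case: f2 fE wf2 => // z' f2 fE /= /andP[/eqP zz' _]; rewrite {z'}zz' in fE.
  case: g2 gE wg2 => // z' g2 gE wg2; have /= /andP[/eqP zz' _] := wg2.
  rewrite {z'}zz' in gE wg2.
  have ww : walk G' (fs i) (f1 ++ z :: g2) (gt k).
    move: wf1; case: (f1) => [|a f1']; first by case/and3P => /eqP<-.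
    move: wg2; rewrite /= => /and3P[_ pg lg] /and3P[-> pz _].
    move: pz; rewrite rcons_path => /andP[p1 p2].
    rewrite cat_path last_cat /= lg pg andbT p1 /= andbT; exact: p2.
  have [w + wS] := separatesP _ _ _ _ sepS _ _ _ sA tB ww.
  suff E : w \in f1 ++ z :: g2 -> w = z.
    by move=> /E wz; rewrite wz in wS; rewrite -(fend z) -?(gend z).
  rewrite mem_cat inE => /or3P[wf1'|/eqP //|wg2'].
    have wp : w = p i by apply: fend => //; rewrite fE mem_cat wf1'.
    have : p i \in z :: f2.
      have : walk G' z (z :: f2) (p i) by rewrite fE in wf; have [] := walk_cut wf.
      exact: walk_last.
    move=> pz; move: uf; rewrite fE cat_uniq => /and3P[_ /hasPn/(_ _ pz)/=].
    by rewrite -wp wf1'.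
  have wq : w = q k by apply: gend => //; rewrite gE mem_cat inE wg2' !orbT.
  move: ug; rewrite gE cat_uniq /=; case: (g1) wg1 => [|a g1'] /=.
    by case/andP => /eqP zq _ /and3P[_ + _]; rewrite zq -wq wg2'.
  case/and3P => /eqP-> _ _ /and3P[_ /norP[_ /hasPn/(_ _ wg2')]].
  by rewrite /= wq mem_head.
apply: (@linked_shorten _ _ _ _
  (fun i => f i ++ (if p i == x then g (j i) else behead (g (j i)))) fs (gt \o j)).
  move=> i; have [sA pP wf uf] := fh i; have [qQ tB wg ug] := gh (j i); split=> //=.
  have {}wf : walk G (fs i) (f i) (p i) by apply: sub_walk wf => u v _ _; apply: subG.
  have {}wg : walk G (q (j i)) (g (j i)) (gt (j i)).
    by apply: sub_walk wg => u v _ _; apply: subG.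
  move: wg; rewrite qj /q'; case: eqP => [px|_] wg.
    by apply: walk_cat wf _ wg; rewrite px.
  case: (f i) wf => // a s /= /and3P[-> ps /eqP ls].
  case: (g (j i)) wg => // b r /and3P[/eqP bp pr lr].
  by rewrite cat_path last_cat ls /= -bp pr ps.
have sub i z : z \in f i ++ (if p i == x then g (j i) else behead (g (j i))) ->
    z \in f i \/ z \in g (j i).
  rewrite mem_cat => /orP[|]; first by left.
  by case: ifP => _; [right|move/mem_behead; right].
have cross i i' z : z \in f i -> z \in g (j i') -> i = i'.
  move=> zf zg; have [zS zp zq] := meet _ _ _ zf zg.
  apply: injP; move: zq; rewrite qj /q' -zp; case: eqP => // _ zy.
  by rewrite -zy zS in yS.
move=> i i' z /sub[zi|zi] /sub[zi'|zi'].
- exact: fd zi zi'.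
- exact: cross zi zi'.
- by apply/esym; apply: cross zi' zi.
have jj := gd _ _ _ zi zi'.
case: (eqVneq i i') => // nii; have := congr1 q jj; rewrite !qj /q'.
have px k : p k != x -> p k \in S.
  by have [_ + _ _] := fh k; rewrite !inE => /orP[->|].
case: eqP => [pi|/eqP pi]; case: eqP => [pi'|/eqP pi'] //.
- by move=> _; apply: injP; rewrite pi.
- by move=> yE; have := px _ pi'; rewrite -yE (negPf yS).
- by move=> yE; have := px _ pi; rewrite yE (negPf yS).
exact: injP.
Qed.

End Menger.

(** * Consequences of the connectivity *)

Section Connectivity.
Variables (T : finType) (e : rel T).
Hypotheses (es : symmetric e) (ei : irreflexive e).

(** The set of paths between the neighbourhoods becomes a set of internally
    disjoint paths between x and y; an edge x y adds one more. *)
Lemma linked_local_connectivity x y n : x != y ->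
  linked (fun u v => [&& e u v, u \notin [:: x; y] & v \notin [:: x; y]])
    [set u | e x u & u != y] [set u | e u y & u != x] n ->
  n + e x y <= local_connectivity e x y.
Proof.
move=> nxy [f [s [t [fh fd]]]].
have fh' i : [/\ path e x (rcons (f i) y), uniq (x :: rcons (f i) y) & s i \in f i].
  have [sA tB wf uf] := fh i; have wh := walk_head wf.
  move: sA tB; rewrite !inE => /andP[xs sy] /andP[ty tx].
  have sx : s i != x by apply: contraTneq xs => ->; rewrite ei.
  case: (f i) wf wh uf => // a r /and3P[/eqP-> pr /eqP lr] wh uf; split=> //.
    rewrite rcons_cons /= xs rcons_path lr ty andbT.
    by apply: sub_path pr => u v /and3P[].
  have ar : all [pred z | z \notin [:: x; y]] (s i :: r).
    rewrite /= !inE negb_or sx sy /=; elim: r (s i) pr {uf wh lr} => //= b r IH u.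
    by case/andP => /and3P[_ _ ->] /IH.
  have [nx ny] : x \notin s i :: r /\ y \notin s i :: r.
    by split; apply/negP => /(allP ar) /=; rewrite !inE eqxx ?orbT.
  by rewrite cons_uniq mem_rcons rcons_uniq uf ny inE negb_or nxy nx.
have /fin_all_exists[b bE] i : exists b : #|T|.-bseq T, bseqval b = rcons (f i) y.
  have [_ u _] := fh' i.
  suff sz : size (rcons (f i) y) <= #|T| by exists (Bseq sz).
  move: u; rewrite cons_uniq => /andP[_ /card_uniqP <-]; exact: max_card.
have s1 : size [:: y] <= #|T| by apply/card_gt0P; exists x.
pose b1 := Bseq s1.
pose P := [set b i | i in setT] :|: (if e x y then [set b1] else set0).
have injb : injective b.
  move=> i j /(congr1 (@bseqval _ _)); rewrite !bE => /rcons_inj[fij].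
  have [_ _ si] := fh' i; apply: (fd _ _ _ si); by rewrite -fij.
have -> : n + e x y = #|P|.
  rewrite cardsU disjoint_setI0 ?cards0 ?subn0; last first.
    case: ifP => _; last by rewrite -setI_eq0 setI0.
    rewrite disjoint_sym disjoints1; apply/imsetP => -[i _ /(congr1 (@bseqval _ _))].
    rewrite bE /=; have [_ _] := fh' i; case: (f i) => // a r _ [].
    by case: r.
  rewrite card_imset // cardsT card_ord; congr (_ + _).
  by case: (e x y); rewrite ?cards1 ?cards0.
apply: (leq_bigmax_cond (P := disjoint_paths e x y) P).
have PE p : p \in P ->
    (exists i, bseqval p = rcons (f i) y) \/ (e x y /\ bseqval p = [:: y]).
  rewrite inE => /orP[/imsetP[i _ ->]|]; first by left; exists i; rewrite bE.
  by case: ifP => [exy|]; rewrite inE // => /eqP->; right.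
apply/andP; split; apply/forall_inP => p /PE.
  case=> [[i ->]|[exy ->]]; last by rewrite /is_path /= exy eqxx inE nxy.
  by rewrite /is_path; have [-> -> _] := fh' i; rewrite last_rcons eqxx.
move=> pP; apply/forall_inP => q /PE qP; apply/implyP => npq.
apply/forallP => z; apply/implyP => /andP[].
case: pP => [[i pE]|[_ ->]]; last by [].
case: qP => [[j qE]|[_ ->]]; last by [].
rewrite pE qE !inE !mem_rcons !inE.
do 2![case: eqP => //= _] => zi zj; have ij := fd _ _ _ zi zj.
by case/eqP: npq; apply: val_inj; rewrite /= pE qE ij.
Qed.

(** Two vertices x, y with at most kappa internally disjoint paths are separated
    by at most kappa vertices, except possibly for the edge x y.  If there is that edge,
    one path less is left, so that one of its ends may join the separator; the end
    is chosen so that both sides remain nonempty. *)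
Lemma separation : (connectivity e).+1 < #|T| ->
  exists S B : {set T}, [/\ #|S| <= connectivity e, B != set0, ~: (B :|: S) != set0,
    [disjoint B & S] & forall u v, u \in B -> v \notin B :|: S -> ~~ e u v].
Proof.
set k := connectivity e => kT.
have : ~~ k_connected e k.+1 by rewrite connectivityP ?ltnn //; nat_lia.
rewrite negb_forall => /existsP[x]; rewrite negb_forall => /existsP[y].
rewrite negb_imply -ltnNge ltnS => /andP[nxy lk].
set A := [set u | e x u & u != y]; set B := [set u | e u y & u != x].
pose G u v := [&& e u v, u \notin [:: x; y] & v \notin [:: x; y]].
have lt1 : e x y <= 1 by case: (e x y).
have [/existsP[Z /andP[/separatesP sZ cZ]]|] :=
    boolP [exists Z : {set T}, separates G A B Z && (#|Z| < k.+1 - e x y)]; last first.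
  rewrite negb_exists => /forallP nZ.
  have /(linked_local_connectivity nxy) : linked G A B (k.+1 - e x y).
    by apply: menger => Z sZ; have := nZ Z; rewrite sZ /= -leqNgt.
  by move: lk lt1; nat_lia.
pose S := Z :\: [set x; y].
(* Z may contain x or y, which must stay in the graph: the walks it has to meet
   avoid both. *)
pose R u v := [&& e u v, u \notin S, v \notin S & (u, v) \notin [:: (x, y); (y, x)]].
pose D := [set u | connect R x u].
have SZ : #|S| <= #|Z| by apply/subset_leq_card/subsetDl.
have xS : x \notin S by rewrite !inE eqxx.
have yS : y \notin S by rewrite !inE eqxx orbT.
have xD : x \in D by rewrite inE connect0.
have yD : y \notin D.
  rewrite inE; apply/negP => /connectP[t0 pt0]; case: (shortenP pt0) => t pt ut _ {t0 pt0}.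
  case/lastP: t pt ut => [|t w] pt ut; first by move=> yx; rewrite yx eqxx in nxy.
  rewrite last_rcons => wy; rewrite -{w}wy in pt ut.
  move: ut; rewrite cons_uniq mem_rcons inE rcons_uniq negb_or.
  move=> /andP[/andP[_ xt] /andP[yt ut]].
  case: t pt xt yt ut => [|a t]; first by move=> /= /andP[/and4P[_ _ _]]; rewrite inE eqxx.
  rewrite rcons_cons /= rcons_path => /and3P[xa pt ty] xt yt ut.
  have [z zt zZ] : exists2 z, z \in a :: t & z \in Z.
    apply: (sZ a (a :: t) (last a t)).
    - rewrite inE; case/and4P: xa => -> _ _ _ /=.
      by apply: contra yt => /eqP->; rewrite mem_head.
    - rewrite inE; case/and4P: ty => -> _ _ _ /=.
      by apply: contra xt => /eqP <-; rewrite mem_last.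
    rewrite /= !eqxx andbT /=.
    have sub : {in a :: t &, subrel R G}.
      move=> u v ut' vt' /and4P[euv _ _ _]; rewrite /G euv /= !inE !negb_or.
      have ne z w : z \in a :: t -> w \notin a :: t -> z != w.
        by move=> zt; apply: contraNneq => <-.
      by rewrite !ne.
    by apply: (sub_in_path sub) pt; apply/allP.
  have : z \notin S.
    have aS : a \notin S by case/and4P: xa.
    elim: t a aS pt zt {xa ty xt yt ut} => [|b t IH] a aS /=.
      by rewrite inE => _ /eqP->.
    case/andP => /and4P[_ _ bS _] pt; rewrite inE => /predU1P[->//|].
    exact: IH.
  rewrite !inE zZ andbT negb_or; move=> /nandP[].
    rewrite negbK => /eqP zx; by rewrite -zx zt in xt.
  by rewrite negbK => /eqP zy; rewrite -zy zt in yt.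
have DS u : u \in D -> u \notin S.
  rewrite inE => /connectP[t pt ->].
  suff: forall a, a \notin S -> path R a t -> last a t \notin S by apply.
  elim: (t) => //= b r IH a aS /andP[/and4P[_ _ bS _]]; exact: IH.
have DE u v : u \in D -> v \notin D -> v \notin S -> e u v -> u = x /\ v = y.
  move=> uD vD vS euv; have : ~~ R u v.
    apply: contra vD => ruv; move: uD; rewrite !inE => uD.
    exact: connect_trans uD (connect1 ruv).
  rewrite /R euv vS (DS _ uD) /= negbK !inE => /orP[/eqP[-> ->]//|/eqP[uy _]].
  by rewrite uy (negPf yD) in uD.
have nz (X : {set T}) z : z \in X -> X != set0 by move=> zX; apply/set0Pn; exists z.
case: (boolP (e x y)) => exy; rewrite ?exy ?(negPf exy) in cZ; last first.
  exists S, D; split; rewrite ?(nz D x) ?(nz _ y) //; first by move: cZ SZ; nat_lia.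
  - by rewrite in_setC in_setU negb_or yD.
  - by rewrite disjoint_subset; apply/subsetP => u uD; apply: DS.
  move=> u v uD; rewrite in_setU negb_or => /andP[vD vS].
  apply/negP => euv; have [ux vy] := DE u v uD vD vS euv.
  by rewrite -ux -vy euv in exy.
have [D1|[w wD]] := set_0Vmem (D :\ x).
  exists (y |: S), [set x]; split.
  - by rewrite cardsU1 yS; move: cZ SZ => /=; nat_lia.
  - by apply: (nz _ x); rewrite set11.
  - rewrite -card_gt0; have := cardsC (x |: (y |: S)).
    have := leq_b1 (x \notin y |: S).
    by rewrite !cardsU1 yS; move: cZ SZ kT => /=; nat_lia.
  - by rewrite disjoints1 in_setU1 negb_or nxy.
  move=> u v /set1P->; rewrite !in_setU !in_set1 !negb_or => /and3P[vx vy vS].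
  have vD : v \notin D.
    apply/negP => vD; have : v \in D :\ x by rewrite in_setD1 vx.
    by rewrite D1 inE.
  by apply/negP => /(DE _ _ xD vD vS)[_ /eqP]; rewrite (negPf vy).
exists (x |: S), (D :\ x); split.
- by rewrite cardsU1 xS; move: cZ SZ => /=; nat_lia.
- exact: (nz _ w).
- apply: (nz _ y); rewrite in_setC !in_setU in_setD1 in_set1 (negPf yD) (negPf yS).
  by rewrite eq_sym (negPf nxy) andbF.
- rewrite disjoint_subset; apply/subsetP => u; rewrite in_setD1 => /andP[ux uD].
  by rewrite inE in_setU in_set1 negb_or ux (DS u uD).
move=> u v; rewrite !in_setU !in_setD1 in_set1 !negb_or => /andP[ux uD].
move=> /and3P[+ vx vS]; rewrite vx /= => vD.
by apply/negP => /(DE _ _ uD vD vS)[/eqP]; rewrite (negPf ux).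
Qed.

End Connectivity.

Section Attachments.
Variables (T : finType) (e : rel T) (c : seq T) (x : T).
Hypotheses (es : symmetric e) (ei : irreflexive e) (cl : longest e c) (xc : x \notin c).

(** Take a vertex y of the cycle that is not attached.  Each of kappa internally
    disjoint paths from x to y enters the cycle in an attached vertex, and these
    entry points are distinct. *)
Lemma connectivity_le_labels : 1 < #|T| -> c != [::] ->
  connectivity e <= #|[set v | label e c x v]|.
Proof.
move=> T1 c0; have uc : uniq c by case: cl.
have [y yc ny] : exists2 y, y \in c & ~~ attached e c x y.
  case E: c c0 => [//|v c'] _; rewrite -E.
  have vc : v \in c by rewrite E mem_head.
  have [av|nav] := boolP (attached e c x (prev c v)).
    exists v => //; apply: (label_not_attached es cl xc); by rewrite /label vc.
  by exists (prev c v); rewrite ?mem_prev.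
have nxy : x != y by apply: contraNneq xc => ->.
have : k_connected e (connectivity e) by rewrite connectivityP.
move=> /forallP/(_ x)/forallP/(_ y)/implyP/(_ nxy) /leq_trans; apply.
apply/bigmax_leqP => P /andP[/forall_inP hP /forall_inP hD].
have first p : p \in P -> exists z, [&& z \in bseqval p, z \in c & attached e c x z].
  move=> /hP /and3P[pp /eqP lp _].
  have /has_first[s1 [z [s2 [E zc ns]]]] : has (mem c) p.
    apply/hasP; exists y => //; case: (bseqval p) lp => [|a s] /= lp.
      by rewrite lp eqxx in nxy.
    by rewrite -lp mem_last.
  exists z; rewrite E mem_cat mem_head orbT /=; apply/andP; split=> //.
  move: pp; rewrite E cat_path /= => /and3P[p1 lz _].
  apply/exists_inP; exists (last x s1); last by rewrite es.
  elim/last_ind: s1 p1 ns {E lz} => [|s1 b IH]; first by rewrite component_self.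
  rewrite rcons_path last_rcons has_rcons negb_or => /andP[p1 eb] /andP[bc ns].
  have bc1 : b \notin c by [].
  by have := component_edge xc (IH p1 ns) bc1 eb.
pose g (p : #|T|.-bseq T) :=
  odflt y [pick z | [&& z \in bseqval p, z \in c & attached e c x z]].
have gE p : p \in P -> [/\ g p \in bseqval p, g p \in c & attached e c x (g p)].
  move=> /first[z hz]; rewrite /g; case: pickP => [w /and3P[]//|/(_ z)].
  by rewrite hz.
rewrite -(@card_in_imset _ _ (fun p => next c (g p)) (mem P)).
  apply/subset_leq_card/subsetP => _ /imsetP[p pP ->]; rewrite inE.
  by have [_ gc ga] := gE p pP; rewrite /label mem_next gc prev_next.
move=> p q pP qP /(next_inj uc) gpq.
have [[zp zc za] [zq _ _]] := (gE p pP, gE q qP).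
apply/eqP; apply: contraT => npq.
have /forall_inP/(_ q qP)/implyP/(_ npq)/forallP/(_ (g p)) := hD p pP.
rewrite inE zp orbT inE gpq zq orbT /= !inE -gpq => /orP[/eqP zx|/eqP zy].
  by move: xc; rewrite -zx zc.
by rewrite -zy za in ny.
Qed.

Lemma labels_indep (Y : {set T}) : {in Y, forall y, label e c x y} ->
  independent e (x |: Y) /\ #|x |: Y| = #|Y|.+1.
Proof.
move=> lY; split; last first.
  rewrite cardsU1; suff -> : x \notin Y by [].
  by apply: contra xc => /lY/andP[].
have nx y : y \in Y -> ~~ e y x.
  by move=> /lY ly; apply: (label_component es cl xc ly); apply: component_self.
apply/independentP => u v; rewrite !in_setU1 => /predU1P[->|uY] /predU1P[->|vY].
- by rewrite ei.
- by rewrite es nx.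
- exact: nx.
exact: label_indep (lY _ uY) (lY _ vY).
Qed.

End Attachments.

(** * Counting lemmas and the case of pairs *)

Section FinSets.
Variable T : finType.
Implicit Types A P U X : {set T}.

Lemma subset_between A P m : A \subset P -> #|A| <= m <= #|P| ->
  exists U : {set T}, [/\ A \subset U, U \subset P & #|U| = m].
Proof.
move=> AP /andP[]; elim: m => [|m IH] Am mP.
  by exists A; split=> //; apply/eqP; rewrite -leqn0.
have [lt|] := ltnP #|A| m.+1; last first.
  by move=> h; exists A; split=> //; apply/eqP; rewrite eqn_leq Am.
have [U [AU UP cU]] := IH lt (ltnW mP).
have /card_gt0P[z] : 0 < #|P :\: U| by rewrite cardsD (setIidPr UP) cU; nat_lia.
rewrite inE => /andP[zU zP]; exists (z |: U); split.
- exact: subset_trans AU (subsetUr _ _).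
- by rewrite subUset sub1set zP.
by rewrite cardsU1 zU cU.
Qed.

Lemma subset_card P m : m <= #|P| -> exists2 U : {set T}, U \subset P & #|U| = m.
Proof.
move=> mP; have [|U [_ UP cU]] := @subset_between set0 P m (sub0set P).
  by rewrite cards0.
by exists U.
Qed.

Lemma sum_le_card A (f : T -> nat) m : (forall v, v \in A -> f v <= m) ->
  \sum_(v in A) f v <= #|A| * m.
Proof. by move=> h; rewrite -sum_nat_const; apply: leq_sum. Qed.

End FinSets.

Section PairCase.
Variables (T : finType) (e : rel T).
Hypotheses (es : symmetric e) (ei : irreflexive e).

(** Let I be a maximum independent set; it contains a vertex x outside the
    separator S.  If I meets the other side too, take y there: all
    neighbours of x and y avoid I, and the common ones are in S.  Otherwise take any
    y on the other side, whose neighbours lie there or in S. *)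
Lemma sigma2_contradiction : (connectivity e).+1 < #|T| -> connectivity e < alpha e ->
  (forall x y, x != y -> ~~ e x y ->
     #|T| + connectivity e < degree e x + degree e y + alpha e) -> False.
Proof.
move=> kT ka hs; have [S [B [cS B0 D0 BS BD]]] := separation ei kT.
have [I iI cI] : {I : {set T} | independent e I & alpha e = #|I|}.
  apply: eq_bigmax_cond; apply/card_gt0P; exists set0.
  by apply/forall_inP => u; rewrite inE.
have iI' := independentP _ _ iI.
have [x xI xS] : exists2 x, x \in I & x \notin S.
  apply/subsetPn; apply: contraTN ka => /subset_leq_card; rewrite -cI; nat_lia.
have side (X Y : {set T}) : Y != set0 -> [disjoint X & Y] ->
    (forall u v, u \in X -> v \in Y -> ~~ e u v) ->
    (forall v, v \notin X -> v \notin S -> v \in Y) -> x \in X -> False.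
  move=> Y0 XY noe cov xX.
  have Nx u v : v \in [set w | e u w] = e u v by rewrite inE.
  have [IY|[y]] := set_0Vmem (I :&: Y); last first.
    rewrite inE => /andP[yI yY].
    have nxy : x != y by apply: contraTneq yY => <-; rewrite (disjointFr XY).
    have := hs x y nxy (noe _ _ xX yY); rewrite /degree -cardsUI.
    have : #|[set w | e x w] :&: [set w | e y w]| <= #|S|.
      apply/subset_leq_card/subsetP => v; rewrite inE !Nx => /andP[xv yv].
      apply: contraT => vS; have [vX|vX] := boolP (v \in X).
        by have := noe _ _ vX yY; rewrite es yv.
      by have := noe _ _ xX (cov v vX vS); rewrite xv.
    have : #|[set w | e x w] :|: [set w | e y w]| <= #|~: I|.
      apply/subset_leq_card/subsetP => v; rewrite inE !Nx inE => /orP[xv|yv].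
        by apply/negP => vI; have := iI' _ _ xI vI; rewrite xv.
      by apply/negP => vI; have := iI' _ _ yI vI; rewrite yv.
    have := cardsC I; rewrite -cI; move: cS; nat_lia.
  have /set0Pn[y yY] := Y0.
  have nxy : x != y by apply: contraTneq yY => <-; rewrite (disjointFr XY).
  have := hs x y nxy (noe _ _ xX yY); rewrite /degree.
  have : #|[set w | e y w]| <= #|Y :\ y| + #|S|.
    apply: leq_trans (leq_card_setU _ _); apply/subset_leq_card/subsetP => v.
    rewrite Nx => yv; rewrite in_setU in_setD1.
    case: (boolP (v \in S)) => vS; rewrite ?orbT //.
    rewrite orbF (_ : v != y) /=; last by apply: contraTneq yv => ->; rewrite ei.
    apply: cov vS; apply/negP => vX; have := noe _ _ vX yY; by rewrite es yv.
  have : #|[set w | e x w]| <= #|~: (I :|: Y)|.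
    apply/subset_leq_card/subsetP => v; rewrite Nx in_setC in_setU negb_or => xv.
    apply/andP; split; apply/negP => vI.
      by have := iI' _ _ xI vI; rewrite xv.
    by have := noe _ _ xX vI; rewrite xv.
  have := cardsC (I :|: Y); rewrite cardsU IY cards0 subn0 -cI.
  have := cardsD1 y Y; rewrite yY; move: cS; nat_lia.
have [xB|xB] := boolP (x \in B).
  apply: (side B (~: (B :|: S))) => //.
  - by rewrite disjoint_subset; apply/subsetP => u uB; rewrite !inE uB.
  - by move=> u v uB; rewrite in_setC => /(BD _ _ uB).
  by move=> v vB vS; rewrite in_setC in_setU (negPf vB).
apply: (side (~: (B :|: S)) B) => //.
- rewrite disjoint_subset; apply/subsetP => u; rewrite !inE negb_or.
  by case/andP.
- by move=> u v; rewrite in_setC es => /BD h /h.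
- by move=> v; rewrite in_setC negbK in_setU => /orP[//|->].
by rewrite in_setC in_setU negb_or xB.
Qed.

End PairCase.

Section LabelDegrees.
Variables (T : finType) (e : rel T) (c : seq T) (x : T).
Hypotheses (es : symmetric e) (ei : irreflexive e) (cl : longest e c) (xc : x \notin c).
Let uc : uniq c. Proof. by case: cl. Qed.

Lemma off_degree : degree e x < #|[set v in c | e x v]| + #|component e c x|.
Proof.
rewrite /degree (cardsD1 x (component e c x)) component_self add1n addnS ltnS.
apply: leq_trans (leq_card_setU _ _); apply/subset_leq_card/subsetP => v.
rewrite inE => xv; rewrite in_setU in_setD1 in_set xv andbT.
have [//|vc] := boolP (v \in c).
rewrite (component_edge xc (component_self e c x) vc xv) andbT /=.
by apply: contraTneq xv => ->; rewrite ei.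
Qed.

Section Inner.
Variables (Y : {set T}) (y1 : T).
Hypotheses (lY : {in Y, forall y, label e c x y}) (y1Y : y1 \in Y) (Y2 : 1 < #|Y|).

Lemma inner_card : #|[set p in Y | (p != y1) && (p != last_from c Y y1)]|.+2 = #|Y|.
Proof.
have tY := last_from_mem c y1Y; have nt : last_from c Y y1 != y1.
  apply: contraTneq (last_from_gt0 lY y1Y Y2) => ->; by rewrite clock0.
rewrite (cardsD1 y1 Y) y1Y (cardsD1 (last_from c Y y1) (Y :\ y1)) in_setD1 nt tY /=.
rewrite !add1n; congr _.+2; apply: eq_card => p; rewrite !inE.
by rewrite andbC -andbA andbCA andbC -andbA andbC.
Qed.

(** Two elements of Y are left out, its first and its last one from y1; this is
    the origin of the factor k - 2. *)
Lemma inner_sum m : (forall p, p \in Y -> p != y1 -> p != last_from c Y y1 ->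
    #|between e c Y y1 p| <= m) ->
  \sum_(p in Y | (p != y1) && (p != last_from c Y y1)) #|between e c Y y1 p| <=
  (#|Y| - 2) * m.
Proof.
move=> h; rewrite -inner_card subn2 /=.
apply: leq_trans (sum_le_card (f := fun p => #|between e c Y y1 p|) (m := m) _).
  by apply/eq_leq/eq_bigl => p; rewrite !inE.
by move=> p; rewrite inE => /and3P[pY p1 pt]; apply: h.
Qed.

Lemma between_card p : p \in Y -> #|between e c Y y1 p| <= alpha e - 1.
Proof.
move=> pY; have [i ci] := between_indep es ei cl xc lY y1Y Y2 pY.
have := independent_alpha i; rewrite ci; nat_lia.
Qed.

End Inner.
End LabelDegrees.

(** * The extremal cycle *)

Definition cycle_nbrs (T : finType) (e : rel T) (c : seq T) x := [set v in c | e x v].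

Definition succs (T : finType) (e : rel T) (c : seq T) (x : T) := [set v in c | e x (prev c v)].

(** The chord which makes [swap_vertex] possible. *)
Definition sees_next (T : finType) (e : rel T) (c : seq T) (x v : T) :=
  [exists v' in succs e c x, (v' != v) && e (next c v) v'].

Definition good (T : finType) (e : rel T) (c : seq T) (x : T) :=
  [set v in succs e c x | sees_next e c x v && [forall o, e v o ==> (o \in c)]].

Definition bad (T : finType) (e : rel T) (c : seq T) (x : T) := succs e c x :\: good e c x.

Section Stage.
Variables (T : finType) (e : rel T) (k : nat).
Hypotheses (es : symmetric e) (ei : irreflexive e) (k2 : 1 < k) (kK : k <= connectivity e).
Hypothesis (hs : forall X : {set T}, independent e X -> #|X| = k.+1 ->
  #|T| + connectivity e + (k - 2) * (alpha e - 1) <= \sum_(v in X) degree e v).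

(** Take k labels and x as independent set.  [label_degree_sum] allows the labels
    at most n + (k - 2)(alpha - 1) - |H|, which leaves kappa + |H| for the
    degree of x; fewer than |H| of its neighbours are in H. *)
Lemma off_nbrs c x : longest e c -> x \notin c -> c != [::] ->
  connectivity e < #|cycle_nbrs e c x|.
Proof.
move=> cl xc c0; have T1 : 1 < #|T|.
  case E: c c0 => [//|v s] _; apply/card_gt1P; exists x, v; split=> //.
  by apply: contraNneq xc => ->; rewrite E mem_head.
have := connectivity_le_labels es cl xc T1 c0; set L := [set v | _] => kL.
have [Y YL cY] := subset_card (leq_trans kK kL).
have lY : {in Y, forall y, label e c x y}.
  by move=> y /(subsetP YL); rewrite inE.
have Y2 : 1 < #|Y| by rewrite cY.
have /card_gt0P[y1 y1Y] : 0 < #|Y| by apply: ltnW.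
have [iX cX] := labels_indep es ei cl xc lY.
have xY : x \notin Y by apply: contra xc => /lY/andP[].
have := hs iX; rewrite cX cY (big_setU1 _ xY) /= => /(_ erefl).
have hU (P : T -> Prop) : {in set0, forall u, P u} by move=> u; rewrite inE.
have := label_degree_sum es ei cl xc lY y1Y Y2 (hU _) (hU _); rewrite cards0 addn0.
have := inner_sum lY y1Y Y2 (fun p pY _ _ => between_card es ei cl xc lY y1Y Y2 pY).
have := off_degree ei xc; rewrite -/(cycle_nbrs e c x) cY; nat_lia.
Qed.

Section Max.
Variables (c : seq T) (x : T).
Hypotheses (cl : longest e c) (xc : x \notin c).
Hypothesis (kc : connectivity e < #|cycle_nbrs e c x|).
Hypothesis (cmax : forall c' x', longest e c' -> x' \notin c' ->
  #|cycle_nbrs e c' x'| <= #|cycle_nbrs e c x|).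
Let uc : uniq c. Proof. by case: cl. Qed.
Local Notation m := #|cycle_nbrs e c x|.
Local Notation L := (succs e c x).
Local Notation Good := (good e c x).
Local Notation Bad := (bad e c x).
Local Notation H := (component e c x).

Lemma succs_label v : v \in L -> label e c x v.
Proof.
rewrite inE => /andP[vc xv]; rewrite /label vc; apply/exists_inP.
by exists x; rewrite ?component_self // es.
Qed.

Lemma succs_card : #|L| = m.
Proof.
rewrite -(card_imset (cycle_nbrs e c x) (@next_inj _ c uc)); apply: eq_card => v.
apply/idP/imsetP => [|[w]].
  by rewrite inE => /andP[vc xv]; exists (prev c v); rewrite ?inE ?mem_prev ?vc ?next_prev.
by rewrite inE => /andP[wc xw] ->; rewrite inE mem_next wc prev_next.
Qed.

Lemma succs_alpha : m < alpha e.
Proof.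
have [i ci] := labels_indep es ei cl xc succs_label.
by rewrite -succs_card -ci independent_alpha.
Qed.

(** After the exchange of v and x the new cycle is again a longest one, it contains
    all neighbours of v, and m was chosen as large as possible. *)
Lemma good_degree v : v \in Good -> degree e v <= m.
Proof.
rewrite inE => /and3P[]; rewrite inE => /andP[vc xv].
case/exists_inP=> v'; rewrite inE => /andP[v'c xv'] /andP[nv vv'] /forallP ho.
rewrite eq_sym in nv.
have [c' cl' [vc' cc']] := swap_vertex es ei cl xc vc v'c nv xv xv' vv'.
apply: leq_trans (cmax cl' vc'); apply/subset_leq_card/subsetP => w.
rewrite !inE => vw; rewrite vw andbT; apply: cc'.
  by have := ho w; rewrite vw.
by apply: contraTneq vw => ->; rewrite ei.
Qed.

Lemma good_sub : Good \subset L.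
Proof. by apply/subsetP => v; rewrite inE => /andP[]. Qed.

Lemma bad_sub : Bad \subset L.
Proof. exact: subsetDl. Qed.

Lemma good_bad_card : #|Good| + #|Bad| = m.
Proof. by rewrite -succs_card -(cardsID Good L) (setIidPr good_sub). Qed.

(** The vertex that pays nothing because of the bad vertex h: either h itself,
    whose successor sees no label but h, or a neighbour of h off the cycle, which by
    [off_one_label] sees no other label. *)
Definition slot h :=
  if sees_next e c x h then odflt h [pick o | e h o && (o \notin c)] else h.

Lemma slotP h : h \in Bad ->
  (slot h = h /\ ~~ sees_next e c x h) \/ (slot h \notin c /\ e h (slot h)).
Proof.
rewrite !inE => /andP[+ hL]; rewrite hL /= /slot; case: ifP => [_|]; last by left.
rewrite /= negb_forall => /existsP[o]; rewrite negb_imply => ho; right.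
by case: pickP => [o' /andP[]//|/(_ o)]; rewrite ho.
Qed.

Lemma succs_degree_sum (Y E : {set T}) y1 : Y \subset L -> y1 \in Y -> 1 < #|Y| ->
  {in E, forall u, [/\ u \in c, u \notin Bad :\: Y,
     ~~ rightward e c Y y1 u & ~~ leftward e c Y y1 (next c u)]} ->
  \sum_(y in Y) degree e y + #|Bad :\: Y| + #|E| + #|H| <=
  #|T| + \sum_(p in Y | (p != y1) && (p != last_from c Y y1)) #|between e c Y y1 p|.
Proof.
move=> YL y1Y Y2 hE; have lY : {in Y, forall y, label e c x y}.
  by move=> y /(subsetP YL)/succs_label.
have BL h : h \in Bad :\: Y -> [/\ h \in Bad, h \in L, h \notin Y & h \in c].
  rewrite inE => /andP[hY hB]; have hL := subsetP bad_sub h hB; split=> //.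
  by have /andP[] := succs_label hL.
have inj : {in Bad :\: Y &, injective slot}.
  move=> h h' /BL[hB hL _ hc] /BL[h'B h'L _ h'c] hh.
  case: (slotP hB) => [[E1 _]|[o1 e1]]; case: (slotP h'B) => [[E2 _]|[o2 e2]].
  - by rewrite -E1 hh.
  - by rewrite -hh E1 hc in o2.
  - by rewrite hh E2 h'c in o1.
  rewrite -hh in e2.
  exact: (off_one_label es cl xc o1 (succs_label hL) (succs_label h'L) e1 e2).
have dE : [disjoint [set slot h | h in Bad :\: Y] & E].
  rewrite disjoint_subset; apply/subsetP => _ /imsetP[h hBY ->]; rewrite inE.
  apply/negP => sE; have [sc sB _ _] := hE _ sE; have [hB _ _ _] := BL _ hBY.
  case: (slotP hB) => [[E1 _]|[o1 _]]; first by rewrite E1 hBY in sB.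
  by rewrite sc in o1.
pose U := [set slot h | h in Bad :\: Y] :|: E.
have cU : #|U| = #|Bad :\: Y| + #|E|.
  by rewrite cardsU disjoint_setI0 // cards0 subn0 card_in_imset.
rewrite -(addnA _ #|Bad :\: Y|) -cU.
have tY := last_from_mem c y1Y.
apply: (label_degree_sum es ei cl xc lY y1Y Y2) => u.
  rewrite inE => /orP[/imsetP[h hBY ->]|/hE[_ _ -> ->]//] sc.
  have [hB hL hY hc] := BL _ hBY.
  case: (slotP hB) => [[E1 ns]|[o1 _]]; last by rewrite sc in o1.
  have nh y : y \in Y -> ~~ e h y.
    by move=> yY; apply: (label_indep es ei cl xc (succs_label hL) (lY _ yY)).
  have nnh y : y \in Y -> ~~ e (next c h) y.
    move=> yY; apply: contra ns => hy; apply/exists_inP; exists y.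
      exact: (subsetP YL).
    by rewrite hy andbT; apply: contraNneq hY => <-.
  rewrite E1; apply/andP; split.
    rewrite /rightward; case: ifP => _; apply/exists_inP => -[y yY].
      by rewrite (negPf (nh y yY)).
    by rewrite (negPf (nh y yY)) andbF.
  rewrite /leftward; case: ifP => _; last exact: nnh.
  by apply/exists_inP => -[y yY]; rewrite (negPf (nnh y yY)).
rewrite inE => /orP[/imsetP[h hBY ->]|/hE[-> //]] sc.
have [hB hL hY hc] := BL _ hBY.
case: (slotP hB) => [[E1 _]|[o1 e1]]; first by rewrite E1 hc in sc.
split.
  by apply: contraL e1 => sH; apply: (label_component es cl xc (succs_label hL) sH).
move=> y yY; apply: contraNN hY => sy; rewrite es in sy.
by rewrite (off_one_label es cl xc o1 (succs_label hL) (lY _ yY) e1 sy).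
Qed.

Lemma x_degree : degree e x < m + #|H|.
Proof. exact: off_degree. Qed.

Lemma succs_sum (Y : {set T}) : Y \subset L -> #|Y| = k ->
  #|T| + connectivity e + (k - 2) * (alpha e - 1) <= degree e x + \sum_(y in Y) degree e y.
Proof.
move=> YL cY; have lY : {in Y, forall y, label e c x y}.
  by move=> y /(subsetP YL)/succs_label.
have [iX cX] := labels_indep es ei cl xc lY.
have xY : x \notin Y by apply: contra xc => /lY/andP[].
by have := hs iX; rewrite cX cY (big_setU1 _ xY) /= => /(_ erefl).
Qed.

(** The count of [off_nbrs] once more, now with the slots of the bad vertices. *)
Lemma bad_card (Y : {set T}) : Y \subset L -> #|Y| = k -> #|Bad :\: Y| + connectivity e < m.
Proof.
move=> YL cY; have Y2 : 1 < #|Y| by rewrite cY.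
have /card_gt0P[y1 y1Y] : 0 < #|Y| by apply: ltnW.
have lY : {in Y, forall y, label e c x y}.
  by move=> y /(subsetP YL)/succs_label.
have h1 := succs_sum YL cY.
have h2 : {in set0, forall u, [/\ u \in c, u \notin Bad :\: Y,
     ~~ rightward e c Y y1 u & ~~ leftward e c Y y1 (next c u)]}.
  by move=> u; rewrite inE.
have := succs_degree_sum YL y1Y Y2 h2; rewrite cards0 addn0.
have h3 := inner_sum lY y1Y Y2 (fun p pY _ _ => between_card es ei cl xc lY y1Y Y2 pY).
have := x_degree; rewrite cY in h3; move: h1 h3; nat_lia.
Qed.

Lemma good_card : connectivity e < #|Good|.
Proof.
have gb := good_bad_card.
have [kG|kG] := leqP k #|Good|.
  have [Y YG cY] := subset_card kG.
  have := bad_card (subset_trans YG good_sub) cY.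
  have -> : Bad :\: Y = Bad.
    apply/setDidPl; rewrite disjoint_sym; apply: disjointWl YG _.
    by rewrite disjoint_subset; apply/subsetP => v vG; rewrite inE /bad in_setD vG.
  nat_lia.
have [|Y [GY YL cY]] := @subset_between _ Good L k good_sub.
  by rewrite succs_card; move: kG kc kK; nat_lia.
have := bad_card YL cY.
have -> : Bad :\: Y = L :\: Y.
  by rewrite /bad setDDl (setUidPr GY).
by rewrite cardsD (setIidPr YL) succs_card cY; move: kK; nat_lia.
Qed.

(** Fill the pair up to k elements of L by good vertices, whose degrees are at most
    m < alpha. *)
Lemma pair_degree i j : i \in L -> j \in L -> i != j ->
  #|T| + connectivity e < degree e i + degree e j + m + #|H|.
Proof.
move=> iL jL nij; have gc := good_card.
have [|W WG cW] := @subset_card _ (Good :\: [set i; j]) (k - 2).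
  rewrite cardsD; have : #|Good :&: [set i; j]| <= 2.
    by rewrite (leq_trans (subset_leq_card (subsetIr _ _))) // cards2; case: (i != j).
  move: kK gc; nat_lia.
have iW : i \notin W by apply/negP => /(subsetP WG); rewrite !inE eqxx.
have jW : j \notin W by apply/negP => /(subsetP WG); rewrite !inE eqxx orbT.
have ijW : i \notin j |: W by rewrite in_setU1 negb_or nij.
have WG' : W \subset Good := subset_trans WG (subsetDl _ _).
have YL : i |: (j |: W) \subset L.
  by rewrite !subUset !sub1set iL jL (subset_trans WG' good_sub).
have cY : #|i |: (j |: W)| = k by rewrite !cardsU1 ijW jW cW; move: k2; nat_lia.
have := succs_sum YL cY; rewrite !big_setU1 //=.
have := sum_le_card (f := degree e) (fun v vW => good_degree (subsetP WG' v vW)).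
rewrite cW => h1 h2; have h3 := x_degree; have h4 := succs_alpha.
have : (k - 2) * m <= (k - 2) * (alpha e - 1) by rewrite leq_mul2l; apply/orP; right; nat_lia.
by move: h1 h2 h3; nat_lia.
Qed.

Lemma set0_all (P : T -> Prop) : {in set0, forall u, P u}.
Proof. by move=> u; rewrite inE. Qed.

(** Upper and lower bound for the degree sum of a pair: a pair has no elements
    between its first and last one, so every vertex that pays nothing counts. *)
Lemma pair_uncovered i j (E : {set T}) : i \in L -> j \in L -> i != j ->
  {in E, forall u, [/\ u \in c, u \notin Bad :\: [set i; j],
     ~~ rightward e c [set i; j] i u & ~~ leftward e c [set i; j] i (next c u)]} ->
  #|Bad :\: [set i; j]| + #|E| + connectivity e < m.
Proof.
move=> iL jL nij hE; have YL : [set i; j] \subset L by rewrite subUset !sub1set iL.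
have cY : #|[set i; j]| = 2 by rewrite cards2 nij.
have Y2 : 1 < #|[set i; j]| by rewrite cY.
have lY : {in [set i; j], forall y, label e c x y}.
  by move=> y /(subsetP YL)/succs_label.
have iY : i \in [set i; j] by rewrite set21.
have := succs_degree_sum YL iY Y2 hE.
have := inner_sum lY iY Y2 (fun p pY _ _ => between_card es ei cl xc lY iY Y2 pY).
rewrite cY subnn mul0n leqn0 => /eqP->.
rewrite big_setU1 ?inE // big_set1 /=; have := pair_degree iL jL nij; nat_lia.
Qed.

Lemma succs_component_disjoint (B : {set T}) : [disjoint L & B] -> [disjoint H & B] ->
  #|L :|: H :|: B| = m + #|H| + #|B|.
Proof.
move=> LB HB; rewrite cardsU setIUl (disjoint_setI0 LB) (disjoint_setI0 HB) setU0 cards0 subn0.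
rewrite cardsU disjoint_setI0 ?cards0 ?subn0 ?succs_card //.
rewrite disjoint_subset; apply/subsetP => v /succs_label/andP[vc _]; rewrite inE.
by apply: contraL vc => /(component_off xc).
Qed.

Lemma nbr_avoid v w : v \in L -> e v w -> w \notin L :|: H.
Proof.
move=> vL vw; rewrite in_setU negb_or; apply/andP; split; apply: contraL vw.
  by move=> wL; apply: (label_indep es ei cl xc (succs_label vL) (succs_label wL)).
by move=> wH; apply: (label_component es cl xc (succs_label vL) wH).
Qed.

(** The neighbours of i and j avoid both L and H, of total size m + |H|. *)
Lemma pair_common i j : i \in L -> j \in L -> i != j ->
  connectivity e < #|[set w | e i w] :&: [set w | e j w]|.
Proof.
move=> iL jL nij; have := pair_degree iL jL nij; rewrite /degree -cardsUI.
have : #|[set w | e i w] :|: [set w | e j w]| <= #|~: (L :|: H :|: set0)|.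
  apply/subset_leq_card/subsetP => w; rewrite setU0 in_setC => /setUP[].
    by rewrite in_set; apply: nbr_avoid.
  by rewrite in_set; apply: nbr_avoid.
have := cardsC (L :|: H :|: set0); rewrite succs_component_disjoint.
- by rewrite cards0; nat_lia.
- by rewrite -setI_eq0 setI0.
- by rewrite -setI_eq0 setI0.
Qed.

Lemma last_from_pair u v : u \in L -> v \in L -> u != v -> last_from c [set u; v] u = v.
Proof.
move=> uL vL nuv; have lY : {in [set u; v], forall y, label e c x y}.
  by move=> y /set2P[]->; apply: succs_label.
have uY : u \in [set u; v] by rewrite set21.
have Y2 : 1 < #|[set u; v]| by rewrite cards2 nuv.
have /set2P[tu|//] := last_from_mem c uY.
by have := last_from_gt0 lY uY Y2; rewrite tu clock0.
Qed.

Lemma succ_not_bad v : v \in L -> (v \in Good : nat) + (v \in Bad) = 1.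
Proof. by move=> vL; rewrite in_setD vL andbT; case: (v \in Good). Qed.

Lemma succs_mem v : v \in L -> v \in c.
Proof. by move/succs_label/andP => []. Qed.

Section Side.
Variables (S B : {set T}).
Hypotheses (cS : #|S| <= connectivity e) (BS : [disjoint B & S])
  (noe : forall u v, u \in B -> v \notin B :|: S -> ~~ e u v) (LB : [disjoint L & B]).
Local Notation P := (L :\: S).

Lemma P_noe a b : a \in P -> b \in B -> ~~ e b a.
Proof.
rewrite inE => /andP[aS aL] bB; apply: noe bB _.
by rewrite in_setU negb_or aS andbT (disjointFr LB).
Qed.

Lemma P_card : m <= #|P| + connectivity e.
Proof.
rewrite -succs_card -(cardsID S L) addnC leq_add2l; apply: leq_trans cS.
exact/subset_leq_card/subsetIr.
Qed.

Lemma B_degree b : b \in B -> degree e b < #|B| + connectivity e.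
Proof.
move=> bB; rewrite (cardsD1 b B) bB add1n addSn ltnS.
apply: leq_trans (leq_add (leqnn _) cS); apply: leq_trans (leq_card_setU _ _).
apply/subset_leq_card/subsetP => v; rewrite inE => bv; rewrite in_setU in_setD1.
have -> /= : v != b by apply: contraTneq bv => ->; rewrite ei.
rewrite -in_setU; apply: contraLR bv; exact: noe.
Qed.

(** Otherwise a, b and k - 1 of these good vertices are independent.  Since a
    and b are on different sides their degrees add up to less than n + kappa - m,
    too little for the hypothesis on sigma. *)
Lemma good_nonadj a b : a \in P -> b \in B ->
  #|[set v in Good | ~~ e b v] :\ a| <= k - 2.
Proof.
move=> aP bB; have aL : a \in L by move: aP; rewrite inE => /andP[].
rewrite leqNgt; apply/negP => lt.
have [W WG cW] : exists2 W : {set T},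
    W \subset [set v in Good | ~~ e b v] :\ a & #|W| = k - 1.
  by apply: subset_card; move: lt k2; nat_lia.
have hW v : v \in W -> [/\ v \in Good, v \in L, v != a & ~~ e b v].
  move=> /(subsetP WG); rewrite in_setD1 in_set => /and3P[va vG bv]; split=> //.
  exact: subsetP good_sub _ vG.
have aW : a \notin W by apply/negP => /hW[_ _]; rewrite eqxx.
have YL v : v \in a |: W -> v \in L by rewrite in_setU1 => /predU1P[->//|/hW[]].
have bY : b \notin a |: W by apply: contraL bB => /YL vL; rewrite (disjointFr LB).
have nb v : v \in a |: W -> ~~ e b v.
  by rewrite in_setU1 => /predU1P[->|/hW[]//]; apply: P_noe aP bB.
have iX : independent e (b |: (a |: W)).
  apply/independentP => u v; rewrite !(in_setU1 _ b) => /predU1P[->|uY] /predU1P[->|vY].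
  - by rewrite ei.
  - exact: nb.
  - by rewrite es nb.
  exact: (label_indep es ei cl xc (succs_label (YL _ uY)) (succs_label (YL _ vY))).
have cX : #|b |: (a |: W)| = k.+1 by rewrite !cardsU1 bY aW cW; move: k2; nat_lia.
have := hs iX cX; rewrite !big_setU1 //=.
have gW v : v \in W -> degree e v <= m by case/hW => /good_degree.
have := sum_le_card gW.
have := B_degree bB; have h4 := succs_alpha.
have : degree e a <= #|~: (L :|: B)|.
  apply/subset_leq_card/subsetP => w; rewrite in_set => aw; rewrite in_setC in_setU negb_or.
  have := nbr_avoid aL aw; rewrite in_setU negb_or => /andP[-> _] /=.
  by apply: contraL aw => wB; rewrite es P_noe.
have := cardsC (L :|: B); rewrite cardsU (disjoint_setI0 LB) cards0 subn0 succs_card cW.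
have : (k - 2) * m <= (k - 2) * (alpha e - 1) by rewrite leq_mul2l; apply/orP; right; nat_lia.
have -> : (k - 1) * m = m + (k - 2) * m by rewrite -mulSn; congr (_ * _); move: k2; nat_lia.
nat_lia.
Qed.

Section Vertex.
Variables (b : T).
Hypothesis (bB : b \in B).
Local Notation GF := [set v in Good | e b v].
Local Notation F := [set v in L | e b v].

Lemma GF_card a : a \in P -> #|Good| <= #|GF| + (a \in Good) + (k - 2).
Proof.
move=> aP; rewrite -addnA -(cardsID [set v | e b v] Good); apply: leq_add.
  by apply/eq_leq/eq_card => v; rewrite !inE.
have -> : Good :\: [set v | e b v] = [set v in Good | ~~ e b v].
  by apply/setP => v; rewrite !in_setD !in_set andbC.
rewrite (cardsD1 a) leq_add ?good_nonadj // in_set.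
by case: (a \in Good) => //=; case: (~~ _).
Qed.

Lemma GF_sub : GF \subset F.
Proof.
apply/subsetP => v; rewrite inE => /andP[vG bv].
by rewrite in_set bv andbT (subsetP good_sub).
Qed.

Lemma F_card a : a \in P -> 1 < #|F|.
Proof.
move=> aP; apply: leq_trans (subset_leq_card GF_sub).
have := GF_card aP; have := good_card; have := leq_b1 (a \in Good); move: kK k2; nat_lia.
Qed.

Lemma b_on_cycle a : a \in P -> b \in c.
Proof.
move=> aP; apply: contraT => bc; have /card_gt1P[u [v [uF vF /eqP nuv]]] := F_card aP.
move: uF vF; rewrite !(in_set (fun v => (v \in L) && e b v)) => /andP[uL bu] /andP[vL bv].
rewrite es in bu; rewrite es in bv; case: nuv.
exact: (off_one_label es cl xc bc (succs_label uL) (succs_label vL) bu bv).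
Qed.

Hypothesis bc : b \in c.
Local Notation pos := (clock c b).
Variables (i j : T).
Hypotheses (iF : i \in F) (jF : j \in F) (imax : forall f, f \in F -> pos f <= pos i)
  (jmin : forall f, f \in F -> pos j <= pos f) (F2 : 1 < #|F|).

Let F_L f : f \in F -> f \in L. Proof. by rewrite inE => /andP[]. Qed.
Let F_b f : f \in F -> e b f. Proof. by rewrite inE => /andP[]. Qed.
Let F_c f : f \in F -> f \in c. Proof. by move/F_L/succs_mem. Qed.

Lemma pos_gt0 f : f \in F -> 0 < pos f.
Proof.
move=> fF; apply: clock_gt0 => //; first exact: F_c.
by apply: contraTneq (F_b fF) => <-; rewrite ei.
Qed.

Lemma pos_inj u v : u \in c -> v \in c -> pos u = pos v -> u = v.
Proof. exact: clock_inj. Qed.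

Lemma pos_ij : pos j < pos i.
Proof.
have /card_gt1P[u [v [uF vF /eqP nuv]]] := F2.
rewrite ltnNge; apply/negP => h; apply: nuv; apply: pos_inj; [exact: F_c|exact: F_c|].
have := imax uF; have := imax vF; have := jmin uF; have := jmin vF; move: h; nat_lia.
Qed.

Lemma P_notF a : a \in P -> a \notin F.
Proof. by move=> aP; rewrite inE negb_and P_noe ?orbT. Qed.

(** Apply [cross_adjacent] to b and z with every neighbour f of b in L against a
    and against a': in the order from b, either f precedes and z follows, or
    conversely.  Since b has two neighbours in L, z cannot lie between a
    and a'. *)
Lemma conflict_cases a a' z : z \in c -> a \in L -> a' \in L -> e z a -> e z a' ->
  pos a < pos a' -> e (prev c b) (prev c z) ->
  ((forall f, f \in F -> pos f <= pos a) /\ pos a' < pos z) \/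
  ((forall f, f \in F -> pos a' <= pos f) /\ 0 < pos z < pos a).
Proof.
move=> zc aL a'L za za' lt bz.
have nza : z != a by apply: contraTneq za => ->; rewrite ei.
have nza' : z != a' by apply: contraTneq za' => ->; rewrite ei.
have zb : b != z by apply: contraTneq bz => ->; rewrite ei.
have z0 : 0 < pos z by apply: clock_gt0.
have cyc d f : d \in L -> e z d -> f \in F -> f != d ->
    pos f < pos d < pos z \/ pos z < pos d < pos f.
  move=> dL zd fF fd.
  exact: (cross_adjacent es ei cl xc bc zc (succs_label (F_L fF)) (succs_label dL) fd
    (F_b fF) zd bz).
have cyc1 f : f \in F -> f <> a -> pos f < pos a < pos z \/ pos z < pos a < pos f.
  by move=> fF /eqP; apply: cyc.
have cyc2 f : f \in F -> f <> a' -> pos f < pos a' < pos z \/ pos z < pos a' < pos f.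
  by move=> fF /eqP; apply: cyc.
have neq u v : u \in c -> v \in c -> pos u != pos v -> u <> v.
  by move=> uc' vc' /eqP h E; apply: h; rewrite E.
have ac := succs_mem aL; have ac' := succs_mem a'L.
have [h|h|/(pos_inj zc ac')E] := ltngtP (pos z) (pos a'); last by rewrite E eqxx in nza'.
  have [h'|h'|/(pos_inj zc ac)E] := ltngtP (pos z) (pos a); last by rewrite E eqxx in nza.
    right; split; last by rewrite z0.
    move=> f fF; case: (eqVneq f a') => [->//|/eqP n].
    by case: (cyc2 f fF n) => /andP[]; nat_lia.
  exfalso; have key f : f \in F -> f <> a -> f = a'.
    move=> fF n; case: (eqVneq f a') => // /eqP n'.
    by case: (cyc1 f fF n) => /andP[]; case: (cyc2 f fF n') => /andP[]; nat_lia.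
  have ia : i <> a.
    move=> ia; have ja : j <> a by move=> ja; have := pos_ij; rewrite ia ja ltnn.
    by have := pos_ij; rewrite (key j jF ja) ia; nat_lia.
  have := key i iF ia => ia'.
  by case: (cyc1 i iF ia) => /andP[]; rewrite ia'; nat_lia.
left; split=> // f fF; case: (eqVneq f a) => [->//|/eqP n].
by case: (cyc1 f fF n) => /andP[]; nat_lia.
Qed.

(** The good neighbours of b other than f and the bad vertices outside the pair
    make up all of L except at most k <= kappa elements; E is either the set of
    these neighbours or that of their predecessors. *)
Lemma conflict_count a f (E : {set T}) : a \in P -> f \in F -> #|E| = #|GF :\ f| ->
  #|Bad :\: [set a; f]| + #|E| + connectivity e < m -> False.
Proof.
move=> aP fF ->; have aL : a \in L by move: aP; rewrite inE => /andP[].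
have := succ_not_bad aL; have := succ_not_bad (F_L fF); have := GF_card aP.
have := good_bad_card; have := cardsD1 f GF.
have -> : (f \in GF) = (f \in Good) by rewrite in_set (F_b fF) andbT.
have := cardsD1 f (Bad :\ a); have := cardsD1 a Bad.
have -> : Bad :\: [set a; f] = Bad :\ a :\ f by rewrite setDDl.
have : (f \in Bad :\ a) <= (f \in Bad) by rewrite in_setD1; case: (f != a).
by move: kK k2; nat_lia.
Qed.

(** Then the predecessors of the good neighbours of b pay nothing for the pair
    j, a': a chord from such a predecessor to a' is refuted by [ladder_left]. *)
Lemma conflict_left a a' z : z \in c -> a \in L -> a' \in P -> e z a -> e z a' ->
  pos a < pos a' -> e (prev c b) (prev c z) ->
  (forall f, f \in F -> pos f <= pos a) -> pos a' < pos z -> False.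
Proof.
move=> zc aL a'P za za' lt bz Fa az.
have a'L : a' \in L by move: a'P; rewrite inE => /andP[].
have [ac ac'] := (succs_mem aL, succs_mem a'L).
have jL := F_L jF; have jc := F_c jF; have ja := Fa j jF.
have nja : j != a' by apply: contraTneq ja => ->; rewrite -ltnNge.
pose E := [set prev c f | f in GF :\ j].
have cE : #|E| = #|GF :\ j| by rewrite card_imset //; apply: prev_inj.
apply: (conflict_count a'P jF cE); rewrite setUC; apply: pair_uncovered => //.
move=> _ /imsetP[f + ->]; rewrite in_setD1 => /andP[fj /(subsetP GF_sub) fF].
have fL := F_L fF; have fc := F_c fF; have fa := Fa f fF; have jf := jmin fF.
have ltjf : pos j < pos f.
  rewrite ltn_neqAle jf andbT; apply: contra fj => /eqP h.
  by rewrite (pos_inj jc fc h).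
have szj := clock_lt bc jc; have sz := clock_lt bc ac'.
have idx v : v \in c ->
    clock c j v = if pos j <= pos v then pos v - pos j else pos v + size c - pos j.
  exact: clock_base.
have idxf : clock c j f = pos f - pos j by rewrite idx // jf.
have idxa : clock c j a' = pos a' - pos j by rewrite idx // ifT //; nat_lia.
have idxp : clock c j (prev c f) = (pos f - pos j).-1.
  by rewrite clock_prev_pos ?idxf //; nat_lia.
have lab v : v \in [set j; a'] -> ~~ e f v.
  by case/set2P => ->; apply: (label_indep es ei cl xc); apply: succs_label.
split; first by rewrite mem_prev.
- rewrite in_setD negb_and; apply/orP; right; apply/negP => /(subsetP bad_sub)/succs_label.
  move=> /(label_not_attached es cl xc); apply/negP; rewrite negbK.
  by have /andP[] := succs_label fL.
- rewrite /rightward (last_from_pair jL a'L nja) idxp idxa ifT; last by nat_lia.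
  apply/exists_inP => -[y /set2P[]-> /andP[py]]; first by rewrite clock0.
  rewrite idxa => _; move: py; apply/negP; rewrite es.
  have bjL := F_b jF.
  have [h|h] := ltnP (pos f) (pos a).
    apply: (ladder_left es cl xc bc zc (succs_label fL) (succs_label aL) (succs_label a'L)
      _ _ (F_b fF) za bz).
      by rewrite (pos_gt0 fF).
    by rewrite lt.
  have -> : f = a by apply: pos_inj => //; apply/eqP; rewrite eqn_leq fa.
  apply: (ladder_left_eq es cl xc bc zc (succs_label jL) (succs_label aL) (succs_label a'L)
    _ _ (F_b jF) za bz).
    by rewrite (pos_gt0 jF); move: ltjf fa; nat_lia.
  by rewrite lt.
rewrite next_prev // /leftward (last_from_pair jL a'L nja) ifT; last first.
  by rewrite idxf idxa; nat_lia.
by apply/exists_inP => -[y yY]; rewrite (negPf (lab y yY)).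
Qed.

(** Then the good neighbours of b pay nothing for the pair a, i: a chord from a to
    the successor of such a neighbour is refuted by [ladder_right]. *)
Lemma conflict_right a a' z : z \in c -> a \in P -> a' \in L -> e z a -> e z a' ->
  pos a < pos a' -> e (prev c b) (prev c z) ->
  (forall f, f \in F -> pos a' <= pos f) -> 0 < pos z < pos a -> False.
Proof.
move=> zc aP a'L za za' lt bz Fa az.
have aL : a \in L by move: aP; rewrite inE => /andP[].
have [ac ac'] := (succs_mem aL, succs_mem a'L).
have iL := F_L iF; have ic := F_c iF; have ia := Fa i iF.
have nia : a != i by apply: contraTneq ia => <-; rewrite -ltnNge.
apply: (@conflict_count a i (GF :\ i) aP iF erefl); apply: pair_uncovered => //.
move=> f; rewrite in_setD1 => /andP[fi fGF]; have fF := subsetP GF_sub f fGF.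
have fL := F_L fF; have fc := F_c fF; have fa := Fa f fF; have fi' := imax fF.
have ltfi : pos f < pos i.
  rewrite ltn_neqAle fi' andbT; apply: contra fi => /eqP h.
  by rewrite (pos_inj fc ic h).
have szi := clock_lt bc ic.
have idx v : v \in c ->
    clock c a v = if pos a <= pos v then pos v - pos a else pos v + size c - pos a.
  exact: clock_base.
have nc : next c f \in c by rewrite mem_next.
have pn : pos (next c f) = (pos f).+1 by apply: clock_next => //; nat_lia.
have idxi : clock c a i = pos i - pos a by rewrite idx // ifT //; nat_lia.
have idxn : clock c a (next c f) = (pos f).+1 - pos a by rewrite idx // pn ifT //; nat_lia.
have lab v : v \in [set a; i] -> ~~ e f v.
  by case/set2P => ->; apply: (label_indep es ei cl xc); apply: succs_label.
split=> //.
- rewrite in_setD negb_and; apply/orP; right; rewrite /bad in_setD negb_and negbK.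
  by move: fGF; rewrite inE => /andP[->].
- rewrite /rightward; case: ifP => _; apply/exists_inP => -[y yY].
    by rewrite (negPf (lab y yY)).
  by rewrite (negPf (lab y yY)) andbF.
rewrite /leftward (last_from_pair aL iL nia); case: ifP => [_|]; last first.
  rewrite idxn idxi => h; have -> : next c f = i by apply: pos_inj => //; rewrite pn; nat_lia.
  by rewrite ei.
apply/exists_inP => -[y /set2P[]-> /andP[py]]; last by rewrite idxn idxi; nat_lia.
move=> _; move: py; apply/negP; rewrite es.
apply: (ladder_right es cl xc bc zc nc (succs_label aL) (succs_label a'L) az _ _ za' bz).
  by rewrite lt pn ltnS.
by rewrite prev_next // F_b.
Qed.

Lemma no_conflict a a' z (U : {set T}) : z \in c -> U \subset P ->
  a \in i |: (j |: U) -> a' \in i |: (j |: U) -> a != a' -> e z a -> e z a' ->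
  ~~ e (prev c b) (prev c z).
Proof.
move=> zc UP; wlog lt : a a' / pos a < pos a'.
  move=> hw aY a'Y na za za'.
  have YL v : v \in i |: (j |: U) -> v \in c.
    rewrite !in_setU1 => /predU1P[->|/predU1P[->|/(subsetP UP)]]; [exact: F_c|exact: F_c|].
    by rewrite inE => /andP[_ /succs_mem].
  have [h|h|/(pos_inj (YL _ aY) (YL _ a'Y)) E] := ltngtP (pos a) (pos a').
  - exact: hw h aY a'Y na za za'.
  - by apply: hw h a'Y aY _ za' za; rewrite eq_sym.
  by rewrite E eqxx in na.
have YP v : v \in i |: (j |: U) -> v \notin F -> v \in P.
  by rewrite !in_setU1 => /predU1P[->|/predU1P[->|/(subsetP UP)//]]; rewrite ?iF ?jF.
have YL v : v \in i |: (j |: U) -> v \in L.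
  rewrite !in_setU1 => /predU1P[->|/predU1P[->|/(subsetP UP)]]; [exact: F_L|exact: F_L|].
  by rewrite inE => /andP[].
move=> aY a'Y _ za za'; apply/negP => bz.
case: (conflict_cases zc (YL _ aY) (YL _ a'Y) za za' lt bz) => -[hF hz].
  have a'P : a' \in P by apply: YP a'Y _; apply/negP => /hF; nat_lia.
  exact: conflict_left zc (YL _ aY) a'P za za' lt bz hF hz.
have aP : a \in P by apply: YP aY _; apply/negP => /hF; nat_lia.
exact: conflict_right zc aP (YL _ a'Y) za za' lt bz hF hz.
Qed.

(** The count of [off_nbrs] for i, j and U, filled up by good vertices, with slots
    for the bad vertices.  Reading the cycle from i, the vertex b lies before j, so b
    is never in [between]; hence its predecessor can be added to the
    independent sets of [between_indep]. *)
Lemma excess_bound (U : {set T}) : U \subset P -> #|U| <= k - 2 ->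
  #|U| + #|Bad :\: (i |: (j |: U))| + connectivity e < m.
Proof.
move=> UP cU; set Y := i |: (j |: U).
have UL u : u \in U -> u \in L by move=> /(subsetP UP); rewrite inE => /andP[].
have UF u : u \in U -> u \notin F by move=> /(subsetP UP)/P_notF.
have nij : i != j by apply: contraTneq pos_ij => ->; rewrite ltnn.
have jU : j \notin U by apply: contraL jF => /UF.
have iU : i \notin j |: U.
  by rewrite in_setU1 negb_or nij; apply: contraL iF => /UF.
have cY : #|Y| = #|U|.+2 by rewrite !cardsU1 iU jU.
have YL : Y \subset L.
  apply/subsetP => v; rewrite !in_setU1 => /predU1P[->|/predU1P[->|/UL//]]; exact: F_L.
have lY : {in Y, forall y, label e c x y} by move=> y /(subsetP YL)/succs_label.
have iY : i \in Y by rewrite setU11.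
have Y2 : 1 < #|Y| by rewrite cY.
have ic := F_c iF; have jc := F_c jF.
have YF v : v \in Y -> e b v -> v = i \/ v = j.
  rewrite !in_setU1 => /predU1P[->|/predU1P[->|vU bv]]; [by left|by right|].
  by have := UF v vU; rewrite inE bv UL.
have bX p : p \in Y -> p != i -> b \notin between e c Y i p.
  move=> pY pi; rewrite in_set bc /=; apply/negP => /andP[bp /exists_inP[y yY /andP[by' h]]].
  have pj : p = j by case: (YF p pY bp) => // E; rewrite E eqxx in pi.
  move: h; rewrite pj; case: (YF y yY by') => ->; last by rewrite !ltnn andbF.
  have := clock_lt bc ic; have := clock_lt bc jc.
  rewrite clock0 ltn0 andbF /= (clock_base bc ic bc) (clock_base bc ic jc) clock0.
  by have := pos_ij; case_ifs; nat_lia.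
have betw p : p \in Y -> p != i -> p != last_from c Y i -> #|between e c Y i p| <= alpha e - 2.
  move=> pY pi _; have [iX cX] := between_indep es ei cl xc lY iY Y2 pY.
  set X := x |: _ in iX cX.
  have pbc : prev c b \in c by rewrite mem_prev.
  have bnX : prev c b \notin X.
    rewrite in_setU1 negb_or; apply/andP; split; first by apply: contraNneq xc => <-.
    apply/imsetP => -[z zb /(prev_inj uc) bz]; by have := bX p pY pi; rewrite bz zb.
  have nb v : v \in X -> ~~ e (prev c b) v.
    rewrite in_setU1 => /predU1P[->|/imsetP[z + ->]].
      rewrite es; apply: contraL bB => xb; rewrite (disjointFr LB) //.
      by rewrite inE bc xb.
    rewrite in_set => /and3P[zc zp /exists_inP[y yY /andP[zy h]]].
    apply: (no_conflict zc UP pY yY _ zp zy).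
    by apply: contraTneq h => <-; rewrite !ltnn andbF.
  have : independent e (prev c b |: X).
    apply/independentP => u v; rewrite !(in_setU1 _ (prev c b)).
    move=> /predU1P[->|uX] /predU1P[->|vX].
    - by rewrite ei.
    - exact: nb.
    - by rewrite es nb.
    exact: (independentP _ _ iX).
  by move=> /independent_alpha; rewrite cardsU1 bnX cX; nat_lia.
have := succs_degree_sum YL iY Y2 (set0_all _); rewrite cards0 addn0.
have := inner_sum lY iY Y2 betw; rewrite cY subn2 /=.
have [|W WG cW] := @subset_card _ (Good :\: Y) (k - 2 - #|U|).
  rewrite cardsD; have := subset_leq_card (subsetIr Good Y); have := good_card.
  by rewrite cY; move: cU kK k2; nat_lia.
have WG' : W \subset Good := subset_trans WG (subsetDl _ _).
have YW : [disjoint W & Y].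
  apply: disjointWl WG _; rewrite disjoint_subset; apply/subsetP => v.
  by rewrite in_setD => /andP[].
have YWL : Y :|: W \subset L by rewrite subUset YL (subset_trans WG' good_sub).
have cYW : #|Y :|: W| = k.
  rewrite cardsU setIC (disjoint_setI0 YW) cards0 cY cW; move: cU k2; nat_lia.
have := succs_sum YWL cYW.
have -> : \sum_(y in Y :|: W) degree e y =
    \sum_(y in Y) degree e y + \sum_(y in W) degree e y.
  rewrite setUC (big_setID W) /= setUK setDUl setDv set0U (setDidPl _) 1?disjoint_sym //.
  by rewrite addnC.
have := sum_le_card (f := degree e) (fun v vW => good_degree (subsetP WG' v vW)).
rewrite cW; have := x_degree; have h4 := succs_alpha.
have a2 : 1 < alpha e by have := good_bad_card; have := good_card; move: h4 k2 kK; nat_lia.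
set r := k - 2 - #|U|.
have : r * m <= r * (alpha e - 1) by rewrite leq_mul2l; apply/orP; right; nat_lia.
have -> : k - 2 = #|U| + r by rewrite /r; move: cU; nat_lia.
have -> : alpha e - 1 = (alpha e - 2).+1 by nat_lia.
rewrite mulnDl !mulnS; nat_lia.
Qed.

End Vertex.

(** P has at least m - kappa elements.  If at most k - 2, take U = P.  If P contains
    a bad vertex, then at most k - 2 of its elements are good; let U
    consist of them and of bad ones, while the bad elements left out count anyway.
    If all of P is good, it has k - 1 elements; unless k - 2 of them suffice, S is
    contained in L, so x lies outside B and S, and the independent set
    b, x and P contradicts the hypothesis on sigma. *)
Lemma far_side_contradiction b : b \in B -> False.
Proof.
move=> bB.
have mP := P_card; have gb := good_bad_card; have gc := good_card.
have [a aP] : exists a, a \in P.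
  by apply/card_gt0P; move: mP kc; nat_lia.
have Bc u : u \in B -> u \in c by move=> uB; apply: b_on_cycle uB _ aP.
have bc := Bc b bB.
pose F := [set v in L | e b v].
have F2 : 1 < #|F| by apply: F_card aP.
have /card_gt0P[f0 f0F] : 0 < #|F| by apply: ltnW.
have [i iF imax] : exists2 i, i \in F & forall f, f \in F -> clock c b f <= clock c b i.
  by case: (arg_maxnP (clock c b) f0F) => i; exists i.
have [j jF jmin] : exists2 j, j \in F & forall f, f \in F -> clock c b j <= clock c b f.
  by case: (arg_minnP (clock c b) f0F) => j; exists j.
have bound U := excess_bound bB bc iF jF imax jmin F2 (U := U).
have [Pk|Pk] := leqP #|P| (k - 2).
  by have := bound P (subxx _) Pk; nat_lia.
have PG d : d \in P -> #|(P :&: Good) :\ d| <= k - 2.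
  move=> dP; apply: leq_trans (good_nonadj dP bB); apply/subset_leq_card/setSD.
  apply/subsetP => v; rewrite in_setI => /andP[vP vG].
  by rewrite in_set vG P_noe.
have [/exists_inP[d dP dG]|] := boolP [exists d in P, d \notin Good].
  have [|U [GU UP cU]] := @subset_between _ (P :&: Good) P (k - 2) (subsetIl _ _).
    rewrite (ltnW Pk) andbT; have := PG d dP; rewrite (cardsD1 d (P :&: Good)).
    by rewrite in_setI (negPf dG) andbF.
  have := bound U UP; rewrite cU leqnn => /(_ isT).
  have : #|P :\: U| <= #|Bad :\: (i |: (j |: U))|.
    apply/subset_leq_card/subsetP => v; rewrite in_setD => /andP[vU vP].
    rewrite in_setD !in_setU1 !negb_or vU /bad in_setD.
    have /= vL : v \in L by move: vP; rewrite inE => /andP[].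
    have vF := P_notF bB vP.
    have -> : v != i by apply: contraNneq vF => ->.
    have -> : v != j by apply: contraNneq vF => ->.
    rewrite vL !andbT /=; apply: contra vU => vG; apply: (subsetP GU).
    by rewrite in_setI vP.
  by rewrite cardsD (setIidPr UP) cU; nat_lia.
rewrite negb_exists => /forallP PG'.
have PsG v : v \in P -> v \in Good by move=> vP; have := PG' v; rewrite vP negbK.
have cP : #|P| = k - 1.
  have := PG a aP; rewrite (_ : P :&: Good = P); last first.
    by apply/setIidPl/subsetP.
  by have := cardsD1 a P; rewrite aP; move: Pk k2; nat_lia.
have [mk|mk] := leqP (m - connectivity e) (k - 2).
  have [U UP cU] := subset_card (ltnW Pk).
  by have := bound U UP; rewrite cU leqnn => /(_ isT); nat_lia.
have SL : S \subset L.
  apply/setIidPr/eqP; rewrite eqEcard subsetIr /=; apply: leq_trans cS _.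
  by have := cardsID S L; rewrite succs_card cP; move: mk k2; nat_lia.
have xS : x \notin S by apply: contra xc => /(subsetP SL)/succs_mem.
have xB : x \notin B by apply: contra xc => /Bc.
have PL v : v \in P -> v \in L by rewrite inE => /andP[].
have [iX cX] := labels_indep es ei cl xc (fun v vP => succs_label (PL v vP)).
have bX : b \notin x |: P.
  rewrite in_setU1 negb_or; apply/andP; split; first by apply: contraNneq xB => <-.
  by apply: contraL bB => /PL vL; rewrite (disjointFr LB).
have nb v : v \in x |: P -> ~~ e b v.
  rewrite in_setU1 => /predU1P[->|vP]; last exact: P_noe.
  by apply: noe => //; rewrite in_setU negb_or xB.
have iX' : independent e (b |: (x |: P)).
  apply/independentP => u v; rewrite !(in_setU1 _ b) => /predU1P[->|uX] /predU1P[->|vX].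
  - by rewrite ei.
  - exact: nb.
  - by rewrite es nb.
  exact: (independentP _ _ iX).
have cX' : #|b |: (x |: P)| = k.+1 by rewrite cardsU1 bX cX cP; move: k2; nat_lia.
have xP : x \notin P by apply: contra xc => /PL/succs_mem.
have := hs iX' cX'; rewrite !big_setU1 //= (big_setD1 a aP) /=.
have hPa v : v \in P :\ a -> degree e v <= m.
  by rewrite in_setD1 => /andP[_ /PsG/good_degree].
have := sum_le_card hPa; have := cardsD1 a P; rewrite aP cP.
have := B_degree bB; have := x_degree; have h4 := succs_alpha.
have HB : [disjoint H & B].
  rewrite disjoint_subset; apply/subsetP => v vH; rewrite inE.
  by apply: contra (component_off xc vH) => /Bc.
have : degree e a <= #|~: (L :|: H :|: B)|.
  apply/subset_leq_card/subsetP => w; rewrite in_set => aw.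
  rewrite in_setC in_setU negb_or (nbr_avoid (PL a aP) aw) /=.
  by apply: contraL aw => wB; rewrite es P_noe.
have := cardsC (L :|: H :|: B); rewrite (succs_component_disjoint LB HB) add1n.
move=> h1 h2 h3 h5 h6; have -> : #|P :\ a| = k - 2 by move: h6; nat_lia.
have : (k - 2) * m <= (k - 2) * (alpha e - 1) by rewrite leq_mul2l; apply/orP; right; nat_lia.
move: h1 h2 h3 h5; nat_lia.
Qed.

End Side.

(** If a label a lies in B, then all labels outside S do, since a label on
    the other side would share with a more than kappa neighbours, all in S; the two
    sides exchange their roles. *)
Lemma extremal_contradiction : False.
Proof.
have kT : (connectivity e).+1 < #|T|.
  apply: leq_trans (max_card (x |: L)); rewrite cardsU1 succs_card.
  suff -> : x \notin L by move: kc; nat_lia.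
  by apply: contra xc => /succs_mem.
have [S [B [cS B0 D0 BS noe]]] := separation ei kT.
have [LB|] := boolP [disjoint L & B].
  by have /set0Pn[b bB] := B0; apply: (far_side_contradiction cS noe LB bB).
move=> /pred0Pn[a /andP[/= aL aB]]; have /set0Pn[d dD] := D0.
apply: (@far_side_contradiction S (~: (B :|: S)) cS _ _ d dD).
- move=> u v; rewrite in_setC => uBS.
  rewrite in_setU negb_or in_setC negbK in_setU => /andP[/orP[vB|vS] nvS].
    by rewrite es; apply: noe vB uBS.
  by rewrite vS in nvS.
rewrite disjoint_subset; apply/subsetP => v vL; rewrite inE; apply/negP.
rewrite in_setC => vD; have nav : a != v.
  by apply: contraNneq vD => <-; rewrite in_setU aB.
have := pair_common aL vL nav; rewrite ltnNge => /negP; apply; apply: leq_trans cS.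
apply/subset_leq_card/subsetP => w; rewrite !in_setI !in_set => /andP[aw vw].
apply: contraT => wS; have [wB|wB] := boolP (w \in B).
  by have := noe _ _ wB vD; rewrite es vw.
by have := noe _ w aB; rewrite in_setU negb_or wB wS aw => /(_ isT).
Qed.

End Max.

(** The pair of a longest cycle and a vertex off it with most neighbours on it is
    reached by induction on the number of nonneighbours. *)
Lemma longest_spanning c : longest e c -> c != [::] -> forall x, x \in c.
Proof.
move=> cl c0 x; apply: contraT => xc; exfalso; move: cl c0 xc.
have [d] := ubnP (#|T| - #|cycle_nbrs e c x|); elim: d c x => // d IH c x hd cl c0 xc.
apply: (extremal_contradiction cl xc (off_nbrs cl xc c0)) => c' x' cl' xc'.
rewrite leqNgt; apply/negP => lt; have := max_card (cycle_nbrs e c' x').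
have c0' : c' != [::].
  apply: contraTneq lt => ->; rewrite -leqNgt.
  by rewrite (_ : cycle_nbrs e [::] x' = set0) ?cards0 //; apply/setP => v; rewrite !inE.
move=> mx; apply: (IH c' x' _ cl' c0' xc'); move: hd lt mx; nat_lia.
Qed.

End Stage.

(** * The theorem *)

Section Existence.
Variables (T : finType) (e : rel T).
Hypotheses (es : symmetric e) (ei : irreflexive e).

Lemma longest_exists u v : e u v -> exists2 c, longest e c & 1 < size c.
Proof.
move=> uv; pose Q n := [exists c : n.-tuple T, cycle e c && uniq c].
have Q2 : Q 2.
  apply/existsP; exists [tuple u; v]; rewrite /= uv es uv /= inE andbT.
  by apply: contraTneq uv => ->; rewrite ei.
have Qb n : Q n -> n <= #|T|.
  by case/existsP => c /andP[_ /card_uniqP]; rewrite size_tuple => <-; apply: max_card.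
have [n /existsP[c /andP[cc uc]] nmax] := ex_maxnP (ex_intro _ 2 Q2) Qb.
exists c; last by rewrite size_tuple nmax.
split=> // d cd ud; rewrite size_tuple; apply: nmax.
by apply/existsP; exists (in_tuple d); rewrite cd.
Qed.

Lemma connected_edge k : 0 < k -> 1 < #|T| -> k_connected e k -> exists u v, e u v.
Proof.
move=> k0 /card_gt1P[x [y [_ _ nxy]]] /forallP/(_ x)/forallP/(_ y)/implyP/(_ nxy) kc.
have [[u v] uv|no] := pickP [pred uv : T * T | e uv.1 uv.2]; first by exists u, v.
have : local_connectivity e x y <= 0.
  apply/bigmax_leqP => P /andP[/forall_inP hP _]; rewrite leqn0 cards_eq0.
  apply/eqP/setP => p; rewrite inE; apply/negP => /hP /and3P[].
  case: (bseqval p) => [|a s] /=; first by rewrite (negPf nxy).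
  by have /= -> := no (x, a).
by rewrite leqNgt (leq_trans k0 kc).
Qed.

Lemma alpha_gt0 (x : T) : 0 < alpha e.
Proof.
rewrite -(cards1 x); apply: independent_alpha.
by apply/independentP => u v /set1P-> /set1P->; rewrite ei.
Qed.

Lemma labels_alpha c x : longest e c -> c != [::] -> x \notin c -> 1 < #|T| ->
  0 < connectivity e ->
  connectivity e < alpha e /\ (connectivity e).+1 < #|T|.
Proof.
move=> cl c0 xc T1 k0; have := connectivity_le_labels es cl xc T1 c0.
set Y := [set v | _] => kY.
have lY : {in Y, forall y, label e c x y} by move=> y; rewrite inE.
have [iX cX] := labels_indep es ei cl xc lY; split.
  by apply: leq_trans (independent_alpha iX); rewrite cX ltnS.
have /card_gt0P[v vY] : 0 < #|Y| by apply: leq_trans kY.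
have /andP[vc av] := lY v vY.
have nX : prev c v \notin x |: Y.
  rewrite in_setU1 negb_or; apply/andP; split.
    by apply: contraNneq xc => <-; rewrite mem_prev.
  by apply/negP => /lY/(label_not_attached es cl xc); rewrite av.
apply: leq_trans (max_card (prev c v |: (x |: Y))).
by rewrite cardsU1 nX cX; move: kY; nat_lia.
Qed.

End Existence.

Theorem theorem2 (T : finType) (e : rel T) (k : nat)
  (e_sym : symmetric e) (e_irr : irreflexive e)
  (k_gt0 : 1 <= k) (order_ge3 : 3 <= #|T|) (e_kconn : k_connected e k)
  (sigma_ge : ((Posz #|T| + Posz (connectivity e)
                + (Posz k - 2) * (Posz (alpha e) - 1))%R%:E
               <= sigma e k.+1)%E) :
  hamiltonian e.
Proof.
have T1 : 1 < #|T| by apply: ltnW.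
have kK : k <= connectivity e by rewrite -connectivityP.
have [u [v uv]] := connected_edge k_gt0 T1 e_kconn.
have [c cl c2] := longest_exists e_sym e_irr uv.
have c0 : c != [::] by case: (c) c2.
have a0 := alpha_gt0 e_irr u.
suff span : forall x, x \in c.
  exists c => //; case: cl => cc uc _; rewrite /is_cycle cc uc !andbT.
  rewrite (leq_trans order_ge3) // -(card_uniqP uc); apply/subset_leq_card/subsetP => x _.
  exact: span.
have sig (X : {set T}) : independent e X -> #|X| = k.+1 ->
    (Posz #|T| + Posz (connectivity e) + (Posz k - 2) * (Posz (alpha e) - 1)
     <= Posz (\sum_(x in X) degree e x))%R.
  move=> iX cX; rewrite -lee_fin; apply: Order.POrderTheory.le_trans sigma_ge _.
  have PX : independent e X && (#|X| == k.+1) by rewrite iX cX eqxx.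
  exact: (Order.TotalTheory.bigmin_le_cond (+oo)%E
    (P := fun X : {set T} => independent e X && (#|X| == k.+1))
    (fun X => (Posz (\sum_(x in X) degree e x))%:E) PX).
have [k1|k2] := leqP k 1; last first.
  apply: (longest_spanning e_sym e_irr k2 kK _ cl c0) => X iX cX.
  by have := sig X iX cX; rewrite !subzn.
have {k1} k1 : k = 1 by apply/eqP; rewrite eqn_leq k1.
move=> x; apply: contraT => xc.
have [ka kT] := labels_alpha e_sym e_irr cl c0 xc T1 (leq_trans k_gt0 kK).
exfalso; apply: (sigma2_contradiction e_sym e_irr kT ka) => y z nyz eyz.
have iX : independent e [set y; z].
  apply/independentP => a b /set2P[]-> /set2P[]->; rewrite ?e_irr ?eyz //.
  by rewrite e_sym eyz.
have := sig _ iX; rewrite cards2 nyz k1 big_setU1 ?inE // big_set1 /= => /(_ erefl).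
lia.
Qed.
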